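(* Let $w,\tau,v\in W^P$ with $w\ge\tau\ge v$. The Richardson variety $X_w^v$ is smooth at $e_\tau$ if and only if $$l(w)-l(v)=\#\{\alpha\in R^+\setminus R_P^+\ :\ w\ge\tau s_\alpha\ge v\ (\mathrm{mod}\ W_P)\}.$$
   Context: $K$ is an algebraically closed field of arbitrary characteristic, $1\le d<n$, $G=SL_n(K)$, $T$ the diagonal matrices, $B$ the upper triangular and $B^-$ the lower triangular matrices in $G$, $P=P_d\supset B$ the maximal parabolic subgroup of matrices whose lower-left $(n-d)\times d$ block is zero. $G/P$ is identified with the Grassmannian $G_{d,n}$ of $d$-dimensional subspaces of $K^n$. $W=S_n$ is the Weyl group with length function $l$, $W_P=S_d\times S_{n-d}$, $R$ the root system of $(G,T)$, $R^+$ the positive roots for $B$, $R_P^+$ the positive roots of $P$; thus $R^+\setminus R_P^+=\{\epsilon_j-\epsilon_i: 1\le j\le d<i\le n\}$. $s_\alpha$ is the reflection (transposition) for $\alpha$. $I_{d,n}=\{(i_1,\dots,i_d): 1\le i_1<\dots<i_d\le n\}$, ordered by $\underline i\ge\underline j\iff i_t\ge j_t$ for all $t$, is identified with $W/W_P$ and with the set $W^P\subset S_n$ of minimal coset representatives ($\underline i$ corresponds to the permutation with one-line notation $(i_1,\dots,i_d,j_1,\dots,j_{n-d})$, the $j$'s being the complement in increasing order). For $u\in W$, inequalities ''$w\ge u\ge v\ (\mathrm{mod}\ W_P)$'' refer to the element of $I_{d,n}$ corresponding to the coset $uW_P$, i.e. $\{u(1),\dots,u(d)\}$ sorted. For $\tau\in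 W^P$, $e_\tau=\tau P\in G/P$ is the corresponding $T$-fixed point (the span of $e_{\tau(1)},\dots,e_{\tau(d)}$). $X_w=\overline{Be_w}$ is the Schubert variety, $X^v=\overline{B^-e_v}$ the opposite Schubert variety, and $X_w^v=X_w\cap X^v$ the Richardson variety; for $w\ge v$ it is nonempty, reduced and irreducible. *)

(* Defs.v *)
(* All indices are 0-based: {1, ..., n} is 'I_n, and "position at most d"
   reads [j < d]. *)
From HB Require Import structures.
From mathcomp Require Import all_boot all_order all_algebra all_fingroup.
From mathcomp Require Import mpoly.

Set Implicit Arguments.
Unset Strict Implicit.
Unset Printing Implicit Defensive.

Import GRing.Theory.

Local Open Scope ring_scope.

(** ** Weyl group combinatorics *)

(* Permutations compose from left to right, (s * t) x = t (s x), so the product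
   w u of the usual convention is written (u * w)%g. *)

Definition simple_refl (n : nat) : {set 'S_n} :=
  [set tperm p.1 p.2 | p : 'I_n * 'I_n & p.2 == p.1.+1 :> nat].

Lemma simple_refl_gen n : <<simple_refl n>>%g = [set: 'S_n].
Proof.
case: n => [|n].
  apply/eqP; rewrite eqEsubset subsetT; apply/subsetP => s _.
  have -> : s = 1%g by apply/permP => -[].
  exact: group1.
apply/eqP; rewrite eqEsubset subsetT -(gen_tperm (ord0 : 'I_n.+1)) gen_subG.
apply/subsetP => _ /imsetP[y _ ->].
case: y => y; elim: y => [|y IHy] lt_y.
  have -> : Ordinal lt_y = ord0 by apply: val_inj.
  by rewrite tperm1 group1.
have lt_y' : (y < n.+1)%N by exact: ltnW.
have sy : tperm (Ordinal lt_y') (Ordinal lt_y) \in <<simple_refl n.+1>>%g.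
  by apply/mem_gen/imsetP; exists (Ordinal lt_y', Ordinal lt_y); rewrite ?inE.
case: (posnP y) => [y0|y_gt0].
  by have -> : ord0 = Ordinal lt_y' by apply: val_inj; rewrite /= y0.
have -> : tperm ord0 (Ordinal lt_y)
    = (tperm ord0 (Ordinal lt_y') ^ tperm (Ordinal lt_y') (Ordinal lt_y))%g.
  rewrite tpermJ tpermL tpermD // -val_eqE /= ?gtn_eqF //.
by rewrite groupJ // IHy.
Qed.

Lemma word_ex n (w : 'S_n) : exists k, w \in (simple_refl n ^+ k)%g.
Proof.
have /gen_prodgP[k [c cS ->]] : w \in <<simple_refl n>>%g.
  by rewrite simple_refl_gen inE.
exists k; rewrite -[X in (_ ^+ X)%g](card_ord k) -prodg_const.
exact: mem_prodg.
Qed.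

(* Length in the Coxeter group S_n: [simple_refl n ^+ k] is the set of all
   products of k simple reflections. *)
Definition perm_length n (w : 'S_n) : nat := ex_minn (word_ex w).

(* W_P = S_d x S_(n-d). *)
Definition W_P n (d : nat) : {set 'S_n} :=
  [set u : 'S_n | [forall j : 'I_n, (u j < d)%N == (j < d)%N]].

(* W^P: the elements of minimal length in their coset w W_P. *)
Definition min_reps n (d : nat) : {set 'S_n} :=
  [set w : 'S_n | [forall u in W_P n d,
                     (perm_length w <= perm_length (u * w)%g)%N]].

(* I_{d,n}. *)
Definition Idn (n d : nat) : {set d.-tuple 'I_n} :=
  [set t : d.-tuple 'I_n | sorted (fun i j : 'I_n => (i < j)%N) t].

(* The element of I_{d,n} (as a sequence) attached to the coset u W_P: the
   values of u at the first d positions, sorted. *)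
Definition coset_index n (d : nat) (u : 'S_n) : seq 'I_n :=
  sort (fun i j : 'I_n => (i <= j)%N) [seq u j | j : 'I_n <- enum 'I_n & (j < d)%N].

(* u <= v (mod W_P). *)
Definition le_modP n (d : nat) (u v : 'S_n) : bool :=
  all2 (fun i j : 'I_n => (i <= j)%N) (coset_index d u) (coset_index d v).

(* Roots for SL_n: the pair (a, b) stands for the root epsilon_a - epsilon_b. *)
Definition pos_roots (n : nat) : {set 'I_n * 'I_n} :=
  [set a : 'I_n * 'I_n | (a.1 < a.2)%N].

(* Positive roots of the Levi factor of P. *)
Definition pos_roots_P n (d : nat) : {set 'I_n * 'I_n} :=
  [set a in pos_roots n | (a.1 < d)%N == (a.2 < d)%N].

Definition root_refl n (a : 'I_n * 'I_n) : 'S_n := tperm a.1 a.2.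

(** ** The Grassmannian with its Zariski topology *)

Section Grassmannian.

Variables (K : fieldType) (n d : nat).

(* Subsets of the Grassmannian are predicates on subspaces of K^n that hold
   only at subspaces of dimension d. *)
Definition grass (U : {vspace 'cV[K]_n}) : Prop := \dim U = d.

Definition basis_mx (U : {vspace 'cV[K]_n}) : 'M[K]_(n, d) :=
  \matrix_(i, j) (vbasis U)`_j i 0.

(* Homogeneous Pluecker coordinates of U, indexed by I_{d,n}; they depend on the
   basis chosen for U only up to a common nonzero factor. *)
Definition plucker (U : {vspace 'cV[K]_n}) : 'I_#|Idn n d| -> K :=
  fun k => \det (rowsub (tnth (enum_val k)) (basis_mx U)).

(* Closed for the topology induced from P(Lambda^d K^n). *)
Definition zclosed (Z : {vspace 'cV[K]_n} -> Prop) : Prop :=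
  exists2 F : {mpoly K[#|Idn n d|]} -> Prop,
    forall f, F f -> exists k : nat, f \is k.-homog
  & forall U, Z U <-> grass U /\ forall f, F f -> f.@[plucker U] = 0.

Definition subpt (Y Z : {vspace 'cV[K]_n} -> Prop) : Prop :=
  forall U, Y U -> Z U.

Definition zclosure (Y : {vspace 'cV[K]_n} -> Prop) : {vspace 'cV[K]_n} -> Prop :=
  fun U => forall Z, zclosed Z -> subpt Y Z -> Z U.

Definition zirreducible (Z : {vspace 'cV[K]_n} -> Prop) : Prop :=
  (exists U, Z U) /\
  forall Z1 Z2, zclosed Z1 -> zclosed Z2 ->
    subpt Z (fun U => Z1 U \/ Z2 U) -> subpt Z Z1 \/ subpt Z Z2.

(* A chain Z_0 < ... < Z_m of irreducible closed subsets of X through x. *)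
Definition chain_at (X : {vspace 'cV[K]_n} -> Prop) (x : {vspace 'cV[K]_n})
    (m : nat) (Z : nat -> {vspace 'cV[K]_n} -> Prop) : Prop :=
  (forall i, (i <= m)%N ->
     [/\ zclosed (Z i), zirreducible (Z i), subpt (Z i) X & Z i x]) /\
  (forall i, (i < m)%N -> subpt (Z i) (Z i.+1) /\ ~ subpt (Z i.+1) (Z i)).

(* The local dimension of X at x, i.e. the Krull dimension of O_{X,x}, is m. *)
Definition local_dim (X : {vspace 'cV[K]_n} -> Prop) (x : {vspace 'cV[K]_n})
    (m : nat) : Prop :=
  (exists Z, chain_at X x m Z) /\
  (forall m' Z, chain_at X x m' Z -> (m' <= m)%N).

(* y lies on the cone over the embedded projective tangent space to X at x: it
   is killed by the differential at x of every form of the homogeneous ideal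
   of X. *)
Definition tangent (X : {vspace 'cV[K]_n} -> Prop) (x : {vspace 'cV[K]_n})
    (y : 'rV[K]_#|Idn n d|) : Prop :=
  forall (k : nat) (f : {mpoly K[#|Idn n d|]}), f \is k.-homog ->
    (forall U, X U -> f.@[plucker U] = 0) ->
    \sum_i (f^`M(i)).@[plucker x] * y 0 i = 0.

(* X is smooth at x: the Zariski tangent space at x has dimension the local
   dimension m of X.  The cone [tangent X x] has one dimension more, since
   T_x X is its quotient by the line of x (up to a twist by that line). *)
Definition smooth_at (X : {vspace 'cV[K]_n} -> Prop) (x : {vspace 'cV[K]_n})
    : Prop :=
  exists (m : nat) (T : {vspace 'rV[K]_#|Idn n d|}),
    [/\ local_dim X x m, forall y, y \in T <-> tangent X x y & \dim T = m.+1].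

(** ** Schubert and Richardson varieties *)

(* [is_trig_mx] means lower triangular. *)
Definition borel (g : 'M[K]_n) : Prop := \det g = 1 /\ is_trig_mx g^T.
Definition borel_opp (g : 'M[K]_n) : Prop := \det g = 1 /\ is_trig_mx g.

Definition act (g : 'M[K]_n) (U : {vspace 'cV[K]_n}) : {vspace 'cV[K]_n} :=
  (linfun (mulmx g : 'cV[K]_n -> 'cV[K]_n) @: U)%VS.

(* The T-fixed point e_u: the span of e_{u(j)} for j among the first d. *)
Definition fixed_pt (u : 'S_n) : {vspace 'cV[K]_n} :=
  <<[seq (delta_mx (u j) 0%R : 'cV[K]_n) | j : 'I_n <- enum 'I_n & (j < d)%N]>>%VS.

Definition schubert (w : 'S_n) : {vspace 'cV[K]_n} -> Prop :=
  zclosure (fun U => exists2 b, borel b & U = act b (fixed_pt w)).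

Definition schubert_opp (v : 'S_n) : {vspace 'cV[K]_n} -> Prop :=
  zclosure (fun U => exists2 b, borel_opp b & U = act b (fixed_pt v)).

Definition richardson (w v : 'S_n) : {vspace 'cV[K]_n} -> Prop :=
  fun U => schubert w U /\ schubert_opp v U.

End Grassmannian.

(* Main.v *)
(* Both Schubert varieties are cut out by the vanishing of Pluecker coordinates,
   so X_w^v consists of the subspaces whose nonzero coordinates all lie in the
   interval [v, w].

   Dimension: the n x d matrices whose t-th column is supported on the rows
   v_t, ..., w_t span points of X_w^v, and shrinking such bands one step at a
   time, down to e_tau, yields a chain of irreducible closed sets of length
   sum_t (w_t - v_t) = l(w) - l(v).  Conversely every point of X_w^v has a basis
   with distinct top rows a_t and distinct bottom rows b_t, and then
   sum_t (b_t - a_t) <= sum_t (w_t - v_t), so finitely many images of affine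
   spaces of at most that dimension cover X_w^v; a longer chain would give too
   many linearly independent monomials in forms separating its members.

   Tangent space: the coordinates outside [v, w] vanish on X_w^v, and a
   quadratic exchange relation kills the direction of every index that differs
   from tau in at least two entries.  The remaining directions, besides tau
   itself, are those of the tau s_alpha in [v, w], and they are tangent to
   T-stable lines of X_w^v. *)
Require Import Defs.
From HB Require Import structures.
From mathcomp Require Import all_boot all_order all_algebra all_fingroup.
From mathcomp Require Import mpoly zify.
From Stdlib Require Import Classical.

Set Implicit Arguments.
Unset Strict Implicit.
Unset Printing Implicit Defensive.

Import GRing.Theory.

(** * Column spans and their Pluecker coordinates *)

Section ColumnSpan.

Local Open Scope ring_scope.

Variables (K : fieldType) (n d : nat).

Implicit Types (M : 'M[K]_(n, d)) (U : {vspace 'cV[K]_n}) (g h : 'I_d -> 'I_n).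

(** [local_dim] is defined by chains, so the upper bound on the dimension is proved by counting. A
    chain of length m yields (D+1)^m monomials that are independent on its top member, while a
    finite cover by pieces with at most N parameters imposes only O(D^N) conditions on them; letting
    D grow forces m <= N. The count tolerates pieces that overlap and are not closed, so a normal
    form that is not unique is good enough. Density and irreducibility arguments run along
    one-parameter lines of matrices: minors are polynomials in the parameter, and over an infinite
    field a polynomial that vanishes off a finite set is zero. Everything is transported to I_{d,n}.
    A length becomes a sum of entries up to a constant common to w and v. Smoothness becomes the
    equality of [#|tangent_indices|] with the dimension plus one; the extra one is tau, the
    direction of the point itself in the cone [tangent], and the remaining indices match the roots
    bijectively. *)

Definition cspan M : {vspace 'cV[K]_n} :=
  limg (linfun (mulmx M : 'cV[K]_d -> 'cV[K]_n)).

Definition idx (k : 'I_#|Idn n d|) : 'I_d -> 'I_n := tnth (enum_val k).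

(** Coordinates attached to a chosen basis. The basis [basis_mx] behind [plucker] is arbitrary;
    through [minors] it can be traded for a convenient one at the cost of a nonzero factor. *)
Definition minors M : 'I_#|Idn n d| -> K := fun k => \det (rowsub (idx k) M).

Definition coord_mx h : 'M[K]_(n, d) := \matrix_(i, t) (i == h t)%:R.

Lemma cspanP M x : reflect (exists y, x = M *m y) (x \in cspan M).
Proof.
apply: (iffP memv_imgP) => [[y _ ->]|[y ->]].
  by exists y; rewrite lfunE.
by exists y; rewrite ?memvf // lfunE.
Qed.

Lemma cspan_mulr M (C : 'M_d) : C \in unitmx -> cspan (M *m C) = cspan M.
Proof.
move=> uC; apply/vspaceP => x; apply/cspanP/cspanP => -[y ->].
  by exists (C *m y); rewrite mulmxA.
by exists (invmx C *m y); rewrite mulmxA mulmxK.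
Qed.

Lemma act_cspan (b : 'M_n) M : Defs.act b (cspan M) = cspan (b *m M).
Proof.
apply/vspaceP => x; apply/memv_imgP/cspanP => [[_ /cspanP[y ->] ->]|[y ->]].
  by exists y; rewrite lfunE /= mulmxA.
by exists (M *m y); rewrite ?lfunE /= ?mulmxA //; apply/cspanP; exists y.
Qed.

Lemma dim_cspan M : row_full M -> grass d (cspan M).
Proof.
case/row_fullP => B BM; rewrite /grass /cspan limg_dim_eq.
  by rewrite dimvf; apply: muln1.
apply/eqP; rewrite -subv0; apply/subvP => x; rewrite memv_cap memvf /= memv_ker.
rewrite lfunE /= => /eqP Mx; rewrite memv0.
by rewrite -[x]mul1mx -BM -mulmxA Mx mulmx0.
Qed.

Lemma col_basis_mx U (t : 'I_d) : col t (basis_mx d U) = (vbasis U)`_t.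
Proof. by apply/colP => i; rewrite !mxE. Qed.

Lemma mul_basis_mx U (y : 'cV_d) :
  basis_mx d U *m y = \sum_t y t 0 *: (vbasis U)`_t.
Proof.
apply/colP => i; rewrite mxE summxE; apply: eq_bigr => t _.
by rewrite !mxE mulrC.
Qed.

Lemma cspan_basis_mx U : grass d U -> cspan (basis_mx d U) = U.
Proof.
move=> dimU; apply/vspaceP => x; apply/cspanP/idP => [[y ->]|xU].
  rewrite mul_basis_mx; apply: memv_suml => t _; apply: memvZ.
  by apply: vbasis_mem; rewrite mem_nth // size_tuple dimU.
exists (\col_t coord (vbasis U) (cast_ord (esym dimU) t) x).
rewrite mul_basis_mx {1}(coord_vbasis xU).
rewrite (reindex (cast_ord (esym dimU))) /=; last first.
  by exists (cast_ord dimU) => t _; rewrite ?cast_ordK ?cast_ordKV.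
by apply: eq_bigr => t _; rewrite mxE.
Qed.

Lemma row_full_minors M k : minors M k != 0 -> row_full M.
Proof.
rewrite /minors => nz; have uM : rowsub (idx k) M \in unitmx by rewrite unitmxE
  unitfE.
apply/row_fullP; exists (invmx (rowsub (idx k) M) *m rowsub (idx k) 1%:M).
by rewrite -mulmxA mul_rowsub_mx mul1mx mulVmx.
Qed.

Lemma inj_row_full M : (forall y : 'cV_d, M *m y = 0 -> y = 0) -> row_full M.
Proof.
move=> injM; rewrite -col_leq_rank -mxrank_tr row_leq_rank.
apply: inj_row_free => y yM0; apply: trmx_inj; rewrite trmx0; apply: injM.
by apply: trmx_inj; rewrite trmx_mul trmxK yM0 trmx0.
Qed.

Lemma row_full_basis_mx U : grass d U -> row_full (basis_mx d U).
Proof.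
move=> dimU; apply: inj_row_full => y; rewrite mul_basis_mx.
rewrite (reindex (cast_ord dimU)) /=; last first.
  by exists (cast_ord (esym dimU)) => t _; rewrite ?cast_ordK ?cast_ordKV.
have /freeP freeU := basis_free (vbasisP U).
move/(freeU (fun i => y (cast_ord dimU i) 0)) => y0.
by apply/colP => t; rewrite -(cast_ordKV dimU t) y0 mxE.
Qed.

(** The columns of the chosen basis lie in the span of M, which gives C; the product has rank d, and
    this bounds the rank of C from below. *)
Lemma basis_mx_cspan M :
  row_full M -> exists2 C, C \in unitmx & basis_mx d (cspan M) = M *m C.
Proof.
move=> fM; have dimU := dim_cspan fM.
have /fin_all_exists[y yE] t : exists y, col t (basis_mx d (cspan M)) = M *m y.
  apply/cspanP; rewrite col_basis_mx; apply: vbasis_mem.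
  by rewrite mem_nth // size_tuple dimU.
have BE : basis_mx d (cspan M) = M *m \matrix_(i, t) y t i 0.
  apply/matrixP => i t; have /colP/(_ i) := yE t; rewrite mxE => ->.
  by rewrite !mxE; apply: eq_bigr => j _; rewrite mxE.
exists (\matrix_(i, t) y t i 0) => //; rewrite -row_full_unit -col_leq_rank.
have := row_full_basis_mx dimU; rewrite BE -col_leq_rank => /leq_trans; apply.
exact: mxrankM_maxr.
Qed.

Lemma minors_mulr M (C : 'M_d) k : minors (M *m C) k = \det C * minors M k.
Proof. by rewrite /minors -mul_rowsub_mx det_mulmx mulrC. Qed.

Lemma plucker_cspan M : row_full M ->
  exists2 c, c != 0 & forall k, plucker (cspan M) k = c * minors M k.
Proof.
move=> /basis_mx_cspan[C uC BE]; exists (\det C) => [|k].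
  by rewrite -unitfE -unitmxE.
by rewrite -minors_mulr -BE.
Qed.

Lemma plucker_cspan_eq0 M k :
  row_full M -> (plucker (cspan M) k == 0) = (minors M k == 0).
Proof.
by move=> /plucker_cspan[c c0 ->]; rewrite mulf_eq0 (negbTE c0).
Qed.

End ColumnSpan.

(** * Increasing tuples, compared through matchings of their entries *)

Section SortedIndices.

Variables (n d : nat).

Implicit Types (k l : 'I_#|Idn n d|) (h : 'I_d -> 'I_n) (s t : 'I_d).

Lemma idx_mono k s t : (s < t)%N -> (idx k s < idx k t)%N.
Proof.
have := enum_valP k; rewrite inE /idx; set u := enum_val k => us lt_st.
have i0 : 'I_n := tnth u s.
rewrite !(tnth_nth i0); apply: (sorted_ltn_nth _ i0 us) => //.
- by move=> y x z; apply: ltn_trans.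
- by rewrite inE size_tuple.
- by rewrite inE size_tuple.
Qed.

Lemma idx_inj k : injective (idx k).
Proof.
move=> s t E; apply/val_inj/eqP.
by case: ltngtP => // /(idx_mono k); rewrite E ltnn.
Qed.

Lemma eq_idx k l : idx k =1 idx l -> k = l.
Proof.
move=> E; apply/enum_val_inj/eq_from_tnth => t; exact: E.
Qed.

(** Pigeonhole: if g t < f t, then p maps the positions up to t into those strictly before t. The
    lemma turns any matching of entries, such as one read off a determinant, into a comparison of
    the sorted tuples. *)
Lemma leq_matching (f g : 'I_d -> nat) (p : 'S_d) :
    (forall s t, (s < t)%N -> (f s < f t)%N) ->
    (forall s t, (s < t)%N -> (g s < g t)%N) ->
  (forall t, (f (p t) <= g t)%N) -> forall t, (f t <= g t)%N.
Proof.
move=> mf mg le_fg t; rewrite leqNgt; apply/negP => lt_gf.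
have sub : p @: [set s : 'I_d | (s <= t)%N] \subset [set s : 'I_d | (s < t)%N].
  apply/subsetP => _ /imsetP[s + ->]; rewrite !inE => le_st.
  rewrite ltnNge; apply/negP => le_tp.
  have : (f t <= f (p s))%N.
    by move: le_tp; rewrite leq_eqVlt => /predU1P[/val_inj->//|/mf/ltnW].
  have : (g s <= g t)%N.
    by move: le_st; rewrite leq_eqVlt => /predU1P[/val_inj->//|/mg/ltnW].
  have := le_fg s => A B C.
  by have := leq_trans (leq_trans (leq_trans C A) B); move/(_ _ (leqnn _));
    rewrite leqNgt lt_gf.
have := subset_leq_card sub; rewrite card_imset; last exact: perm_inj.
rewrite [X in (X <= _)%N](cardsD1 t) inE leqnn add1n.
have -> : [set s : 'I_d | (s <= t)%N] :\ t = [set s : 'I_d | (s < t)%N].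
  by apply/setP => s; rewrite !inE ltn_neqAle.
by rewrite ltnn.
Qed.

Definition le_idx k l : bool := [forall t, (idx k t <= idx l t)%N].

Lemma le_idxP k l : reflect (forall t, idx k t <= idx l t)%N (le_idx k l).
Proof. exact: forallP. Qed.

Lemma le_idx_matching k l (p : 'S_d) :
  (forall t, (idx k (p t) <= idx l t)%N) -> le_idx k l.
Proof.
move=> le_kl; apply/le_idxP => t.
by apply: (leq_matching (@idx_mono k) (@idx_mono l) le_kl).
Qed.

Lemma le_idx_anti k l : le_idx k l -> le_idx l k -> k = l.
Proof.
move=> /le_idxP kl /le_idxP lk; apply: eq_idx => t.
by apply/val_inj/eqP; rewrite eqn_leq kl lk.
Qed.

Lemma eq_idx_perm k l (p : 'S_d) : (forall t, idx k (p t) = idx l t) -> k = l.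
Proof.
move=> E; apply: le_idx_anti.
  by apply: (@le_idx_matching _ _ p) => t; rewrite E.
by apply: (@le_idx_matching _ _ p^-1%g) => t; rewrite -E permKV.
Qed.

Lemma sort_idx h :
  injective h -> exists k (p : 'S_d), forall t, h t = idx k (p t).
Proof.
move=> injh; pose A := [set h t | t : 'I_d].
have szA : size (enum A) == d by rewrite -cardE card_imset // card_ord.
have sA : sorted (fun i j : 'I_n => (i < j)%N) (Tuple szA).
  rewrite /= /enum_mem -enumT; apply: sorted_filter; first exact: ltn_trans.
  have := iota_ltn_sorted 0 n; rewrite -val_enum_ord.
  by rewrite sorted_map.
have AI : Tuple szA \in Idn n d by rewrite inE.
exists (enum_rank_in AI (Tuple szA)).
have /fin_all_exists[p pE] t : exists s, h t = tnth (Tuple szA) s.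
  by apply/tnthP; rewrite /= mem_enum imset_f.
have injp : injective p by move=> s t E; apply: injh; rewrite !pE E.
by exists (perm injp) => t; rewrite permE pE /idx enum_rankK_in.
Qed.

End SortedIndices.

(** * Minors, and column bases with distinct tops and distinct bottoms *)

Section Minors.

Local Open Scope ring_scope.

Variables (K : fieldType) (n d : nat).

Implicit Types (M : 'M[K]_(n, d)) (g h : 'I_d -> 'I_n) (k l : 'I_#|Idn n d|).

(** Some Leibniz term is nonzero. Its permutation is the matching on which the order comparisons
    rest. *)
Lemma det_neq0_perm m (Q : 'M[K]_m) :
  \det Q != 0 -> exists p : 'S_m, forall s, Q s (p s) != 0.
Proof.
move=> nz; case: (pickP [pred p : 'S_m | [forall s, Q s (p s) != 0]]).
  by move=> p /forallP Qp; exists p.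
move=> no; case/eqP: nz; apply: big1 => p _.
have /negbT/forallPn[s /negPn/eqP Qs0] := no p.
by rewrite (bigD1 s) //= Qs0 mul0r mulr0.
Qed.

(** Triangularity for an arbitrary order, so that upper and lower triangular matrices are treated
    together. A permutation with a nonzero Leibniz term never decreases r; since r and r composed
    with p have equal sums, it must be the identity. *)
Lemma det_trig_rank m (Q : 'M[K]_m) (r : 'I_m -> nat) :
    injective r -> (forall s t, Q s t != 0 -> (r s <= r t)%N) ->
  \det Q = \prod_s Q s s.
Proof.
move=> injr trQ; rewrite /determinant (bigD1 1%g) //= odd_perm1 mul1r.
rewrite [X in _ + X]big1 ?addr0 => [|p p1].
  by apply: eq_bigr => s _; rewrite perm1.
suff /existsP[s /eqP Qs0] : [exists s, Q s (p s) == 0].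
  by rewrite (bigD1 s) //= Qs0 mul0r mulr0.
apply: contraNT p1 => nz; apply/eqP/permP => s; rewrite perm1.
have le_r t : (r t <= r (p t))%N.
  by apply: trQ; apply: contra nz => Q0; apply/existsP; exists t.
have := @leqif_sum _ xpredT (fun t => r t == r (p t)) r (fun t => r (p t)).
case=> [t _|_]; first exact/leqif_eq.
rewrite {1}(reindex_inj (@perm_inj _ p)) eqxx => /esym/forallP/(_ s) /= /eqP.
by move/injr.
Qed.

Lemma det_rowsub_perm M h k (p : 'S_d) :
  (forall t, h t = idx k (p t)) -> \det (rowsub h M) = (-1) ^+ p * minors M k.
Proof.
move=> hE; rewrite /minors -det_perm -det_mulmx -row_permE; congr (\det _).
by apply/matrixP => s t; rewrite !mxE hE.
Qed.

Lemma det_rowsub_not_inj M h : ~ injective h -> \det (rowsub h M) = 0.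
Proof.
move=> ninj; have [/injectiveP//|/injectivePn[s [t st hst]]] := boolP
  (injectiveb h).
by apply: (determinant_alternate st) => j; rewrite !mxE hst.
Qed.

Lemma det_rowsub_neq0 M h : \det (rowsub h M) != 0 ->
  exists k (p : 'S_d), [/\ forall t, h t = idx k (p t) & minors M k != 0].
Proof.
move=> nz; have [/injectiveP injh|ninj] := boolP (injectiveb h); last first.
  by case/eqP: nz; apply: det_rowsub_not_inj => /injectiveP; apply/negP.
have [k [p hE]] := sort_idx injh; exists k, p; split=> //.
by move: nz; rewrite (det_rowsub_perm M hE) mulf_eq0 => /norP[].
Qed.

Lemma row_full_minorsP M : reflect (exists k, minors M k != 0) (row_full M).
Proof.
apply: (iffP idP) => [fM|[k]]; last exact: row_full_minors.
have := fullrowsub_unit fM; rewrite unitmxE unitfE => /det_rowsub_neq0.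
by case=> k [p [_ nz]]; exists k.
Qed.

Lemma det_rowsub_coord_mx g h :
    \det (rowsub g (coord_mx K h)) != 0 ->
  exists p : 'S_d, forall t, g t = h (p t).
Proof.
case/det_neq0_perm => p nz; exists p => t; apply/eqP.
by have := nz t; rewrite !mxE; case: (g t == _); rewrite ?eqxx.
Qed.

Lemma minors_coord_mx k l : minors (coord_mx K (idx k)) l = (l == k)%:R.
Proof.
have [->|nkl] := eqVneq.
  rewrite /minors; have -> : rowsub (idx k) (coord_mx K (idx k)) = 1%:M.
    by apply/matrixP => s t; rewrite !mxE (inj_eq (@idx_inj _ _ k)).
  by rewrite det1.
apply/eqP; apply: contraNT nkl => /det_rowsub_coord_mx[p E].
by apply/eqP/esym/(@eq_idx_perm _ _ _ _ p) => t; rewrite E.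
Qed.

(** The coefficients are 0 or the sign of sorting h. Written as minors of coordinate matrices they
    require no choice of a sorting permutation, and they also cover repeated rows. *)
Lemma det_rowsub_expand M h :
  \det (rowsub h M) =
  \sum_k \det (rowsub h (coord_mx K (idx k))) * minors M k.
Proof.
have [/injectiveP injh|ninj] := boolP (injectiveb h); last first.
  have {}ninj : ~ injective h by move/injectiveP; apply/negP.
  rewrite det_rowsub_not_inj // big1 // => k _.
  by rewrite det_rowsub_not_inj ?mul0r.
have [k [p hE]] := sort_idx injh; rewrite (bigD1 k) //= big1 ?addr0.
  by rewrite !(det_rowsub_perm _ hE) minors_coord_mx eqxx mulr1.
move=> l nkl; rewrite (det_rowsub_perm _ hE) minors_coord_mx eq_sym.
by rewrite (negbTE nkl) mulr0 mul0r.
Qed.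

Lemma coord_mx_full h : injective h -> row_full (coord_mx K h).
Proof.
move=> injh; apply: inj_row_full => y /matrixP y0; apply/colP => t.
have := y0 (h t) 0; rewrite !mxE (bigD1 t) //= mxE eqxx mul1r big1 ?addr0 //.
by move=> s st; rewrite mxE (inj_eq injh) eq_sym (negbTE st) mul0r.
Qed.

Lemma row_full_col_neq0 M t : row_full M -> exists i, M i t != 0.
Proof.
move=> fM; case: (pickP [pred i | M i t != 0]) => [i Mit|M0]; first by exists i.
have /(row_full_inj fM)/colP/(_ t) : M *m delta_mx t 0 = M *m (0 : 'cV_d).
  rewrite mulmx0; apply/colP => i; rewrite -colE !mxE.
  by apply/eqP; have /negPn := negbT (M0 i).
by rewrite !mxE !eqxx => /eqP; rewrite oner_eq0.
Qed.

Definition banded M (a b : 'I_d -> 'I_n) : Prop :=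
  forall i t, M i t != 0 -> (a t <= i <= b t)%N.

(** The columns are not ordered, and the tops may come in another order than the bottoms: nested
    bands such as [1,4] and [2,3] are allowed. *)
Definition echelon M (a b : 'I_d -> 'I_n) : Prop :=
  [/\ injective a, injective b, forall t, M (a t) t != 0,
      forall t, M (b t) t != 0 & banded M a b].

Lemma row_full_band M : row_full M ->
  exists a b : 'I_d -> 'I_n,
    [/\ forall t, M (a t) t != 0, forall t, M (b t) t != 0 & banded M a b].
Proof.
move=> fM.
have /fin_all_exists[a aP] t : exists a : 'I_n,
    M a t != 0 /\ forall i, M i t != 0 -> (a <= i)%N.
  have [i0 Mi0] := row_full_col_neq0 t fM.
  case: (@arg_minnP _ i0 (fun i => M i t != 0) (fun i => i) Mi0) => a Ma le_a.
  by exists a.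
have /fin_all_exists[b bP] t : exists b : 'I_n,
    M b t != 0 /\ forall i, M i t != 0 -> (i <= b)%N.
  have [i0 Mi0] := row_full_col_neq0 t fM.
  case: (@arg_maxnP _ i0 (fun i => M i t != 0) (fun i => i) Mi0) => b Mb le_b.
  by exists b.
exists a, b; split=> [t|t|i t Mit]; rewrite ?(aP t).1 ?(bP t).1 //.
by rewrite (aP t).2 ?(bP t).2.
Qed.

Lemma row_full_mulr M (C : 'M_d) :
  C \in unitmx -> row_full M -> row_full (M *m C).
Proof.
by move=> uC /row_fullP[B BM]; apply/row_fullP; exists (invmx C *m B);
  rewrite -mulmxA (mulmxA B) BM mul1mx mulVmx.
Qed.

Definition add_col (c : K) (s t : 'I_d) : 'M[K]_d := 1%:M + c *: delta_mx s t.

Lemma add_col_unit c s t : s != t -> add_col c s t \in unitmx.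
Proof.
move=> st; have E : add_col c s t *m add_col (- c) s t = 1%:M.
  rewrite /add_col mulmxDl mul1mx mulmxDr mulmx1 -scalemxAl -scalemxAr.
  rewrite mul_delta_mx_0 1?eq_sym // !scaler0 addr0 scaleNr -addrA.
  by rewrite addNr addr0.
by have [] := mulmx1_unit E.
Qed.

Lemma mul_add_col M c s t i u :
  (M *m add_col c s t) i u = M i u + (u == t)%:R * (c * M i s).
Proof.
rewrite /add_col mulmxDr mulmx1 mxE; congr (_ + _).
rewrite -scalemxAr mxE !mxE (bigD1 s) //= mxE eqxx /=.
rewrite big1 ?addr0 => [|j js]; last by rewrite mxE (negbTE js) mulr0.
by rewrite mulrA mulrC.
Qed.

(* A basis of minimal total width has distinct tops and distinct bottoms: if
   two columns end in the same row, subtracting a multiple of the narrower one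
   from the other shrinks the latter. *)
Lemma two_sided_echelon M : row_full M ->
  exists2 C, C \in unitmx & exists a b, echelon (M *m C) a b.
Proof.
move=> fM; have [a [b [Ma Mb bM]]] := row_full_band fM.
have [m] := ubnP (\sum_t (b t - a t))%N.
elim: m => // m IHm in M fM a b Ma Mb bM *; rewrite ltnS => le_m.
have le_ab t : (a t <= b t)%N by have /andP[] := bM _ _ (Ma t).
(* If the modified column t stays inside its old band and vanishes at one end of it, its width drops
   while the other columns keep theirs, so the induction on the total width applies. *)
have step s t c : s != t ->
    (forall i, M i t + c * M i s != 0 -> (a t <= i <= b t)%N) ->
    (M (a t) t + c * M (a t) s = 0) \/ (M (b t) t + c * M (b t) s = 0) ->
  exists2 C, C \in unitmx & exists a b, echelon (M *m C) a b.
  move=> st inab endp; have uA := add_col_unit c st.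
  set M' := M *m add_col c s t; have fM' : row_full M' by apply: row_full_mulr.
  have M'E i u : M' i u = M i u + (u == t)%:R * (c * M i s).
    exact: mul_add_col.
  have M't i : M' i t = M i t + c * M i s by rewrite M'E eqxx mul1r.
  have M'u i u : u != t -> M' i u = M i u.
    by move=> ut; rewrite M'E (negbTE ut) mul0r addr0.
  have [a' [b' [Ma' Mb' bM']]] := row_full_band fM'.
  have aE u : u != t -> a' u = a u.
    move=> ut; apply/val_inj/eqP; rewrite eqn_leq.
    have /andP[-> _] : (a' u <= a u <= b' u)%N by apply: bM'; rewrite M'u.
    by have /andP[] : (a u <= a' u <= b u)%N by apply: bM; rewrite -M'u.
  have bE u : u != t -> b' u = b u.
    move=> ut; apply/val_inj/eqP; rewrite eqn_leq.
    have /andP[_ ->] : (a' u <= b u <= b' u)%N by apply: bM'; rewrite M'u.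
    by have /andP[_ ->] : (a u <= b' u <= b u)%N by apply: bM; rewrite -M'u.
  have lt_t : (b' t - a' t < b t - a t)%N.
    have /andP[aa' _] : (a t <= a' t <= b t)%N by apply: inab; rewrite -M't.
    have /andP[_ bb'] : (a t <= b' t <= b t)%N by apply: inab; rewrite -M't.
    have /andP[ab' _] : (a' t <= b' t <= b' t)%N by apply: bM'.
    suff : (a t != a' t :> nat) || (b t != b' t :> nat).
      by rewrite !neq_ltn; lia.
    case: endp => z0; apply/orP; [left|right]; apply/eqP => /val_inj E.
      by have := Ma' t; rewrite -E M't z0 eqxx.
    by have := Mb' t; rewrite -E M't z0 eqxx.
  have lt_w : (\sum_u (b' u - a' u) < m)%N.
    apply: leq_trans le_m; rewrite (bigD1 t) // [X in (_ < X)%N](bigD1 t) //=.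
    rewrite -addSn leq_add // leq_sum // => u ut.
    by rewrite aE // bE.
  have [C uC ech] := IHm _ fM' _ _ Ma' Mb' bM' lt_w.
  by exists (add_col c s t *m C); rewrite ?mulmxA // unitmx_mul uA.
have M0 (i : 'I_n) u : (i < a u)%N || (b u < i)%N -> M i u = 0.
  move=> out; apply/eqP; apply/negPn/negP => /bM /andP[ai ib].
  by move: out; rewrite ltnNge ai ltnNge ib.
have same_b s t : s != t -> b s = b t -> (a t <= a s)%N ->
    exists2 C, C \in unitmx & exists a b, echelon (M *m C) a b.
  move=> st bst le_a; apply: (step s t (- (M (b t) t / M (b s) s))) => // [i|].
    apply: contraR; rewrite negb_and -!ltnNge => out.
    rewrite (M0 _ _ out) add0r (M0 i s) ?mulr0 ?eqxx // bst.
    by case/orP: out => [/leq_trans->|->]; rewrite ?orbT.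
  by right; rewrite -bst mulNr divfK ?subrr.
have same_a s t : s != t -> a s = a t -> (b s <= b t)%N ->
    exists2 C, C \in unitmx & exists a b, echelon (M *m C) a b.
  move=> st ast le_b; apply: (step s t (- (M (a t) t / M (a s) s))) => // [i|].
    apply: contraR; rewrite negb_and -!ltnNge => out.
    rewrite (M0 _ _ out) add0r (M0 i s) ?mulr0 ?eqxx // ast.
    by case/orP: out => [->|/(leq_ltn_trans le_b)->]; rewrite ?orbT.
  by left; rewrite -ast mulNr divfK ?subrr.
have [/injectiveP ia|/injectivePn[s [t st ast]]] := boolP (injectiveb a).
  have [/injectiveP ib|/injectivePn[s [t st bst]]] := boolP (injectiveb b).
    by exists 1%:M; rewrite ?unitmx1 // mulmx1; exists a, b.
  have [le_a|/ltnW le_a] := leqP (a t) (a s); first exact: same_b st bst le_a.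
  by apply: same_b le_a; rewrite 1?eq_sym.
have [le_b|/ltnW le_b] := leqP (b s) (b t); first exact: same_a st ast le_b.
by apply: same_a le_b; rewrite 1?eq_sym.
Qed.

End Minors.

(** * Polynomial functions and forms *)

Section PolynomialFunctions.

Local Open Scope ring_scope.

Variable K : fieldType.

(** Degree bounds are attached to functions, so that minors and forms of matrices depending on a
    parameter need no matrices over [{poly K}]. *)
Definition polyfun (c : nat) (F : K -> K) : Prop :=
  exists2 p : {poly K}, (size p <= c.+1)%N & forall x, F x = p.[x].

Lemma eq_polyfun c F G : F =1 G -> polyfun c F -> polyfun c G.
Proof. by move=> FG [p sp pE]; exists p => // x; rewrite -FG. Qed.

Lemma polyfun_const c a : polyfun c (fun=> a).
Proof.
exists a%:P => [|x]; rewrite ?hornerC // size_polyC;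
  exact: leq_trans (leq_b1 _) _.
Qed.

Lemma polyfun_affine a b : polyfun 1 (fun x => a + x * b).
Proof.
exists (a%:P + b *: 'X) => [|x]; last by rewrite !hornerE mulrC.
rewrite (leq_trans (size_polyD _ _)) // geq_max size_polyC.
rewrite (leq_trans (leq_b1 _)) //= (leq_trans (size_scale_leq _ _)) //.
by rewrite size_polyX.
Qed.

Lemma polyfunD c F G :
  polyfun c F -> polyfun c G -> polyfun c (fun x => F x + G x).
Proof.
move=> [p sp pE] [q sq qE]; exists (p + q) => [|x];
  last by rewrite hornerD pE qE.
by rewrite (leq_trans (size_polyD _ _)) // geq_max sp.
Qed.

Lemma polyfunM c c' F G :
  polyfun c F -> polyfun c' G -> polyfun (c + c') (fun x => F x * G x).
Proof.
move=> [p sp pE] [q sq qE]; exists (p * q) => [|x];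
  last by rewrite hornerM pE qE.
rewrite (leq_trans (size_polyMleq _ _)) // -subn1 leq_subLR add1n.
by rewrite (leq_trans (leq_add sp sq)) // addSn addnS.
Qed.

Lemma polyfun_sum I (r : seq I) (P : pred I) c (F : I -> K -> K) :
  (forall i, polyfun c (F i)) -> polyfun c (fun x => \sum_(i <- r | P i) F i x).
Proof.
move=> pF; elim: r => [|i r IHr].
  by apply: eq_polyfun (polyfun_const c 0) => x; rewrite big_nil.
case Pi: (P i).
  by apply: eq_polyfun (polyfunD (pF i) IHr) => x; rewrite big_cons Pi.
by apply: eq_polyfun IHr => x; rewrite big_cons Pi.
Qed.

Lemma polyfun_prod I (r : seq I) (c : I -> nat) (F : I -> K -> K) :
    (forall i, polyfun (c i) (F i)) ->
  polyfun (\sum_(i <- r) c i) (fun x => \prod_(i <- r) F i x).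
Proof.
move=> pF; elim: r => [|i r IHr].
  by apply: eq_polyfun (polyfun_const _ 1) => x; rewrite big_nil.
rewrite big_cons; apply: eq_polyfun (polyfunM (pF i) IHr) => x.
by rewrite big_cons.
Qed.

Lemma polyfunX c k F : polyfun c F -> polyfun (c * k) (fun x => F x ^+ k).
Proof.
move=> pF; elim: k => [|k IHk].
  by apply: eq_polyfun (polyfun_const _ 1) => x.
by rewrite mulnS; apply: eq_polyfun (polyfunM pF IHk) => x; rewrite exprS.
Qed.

Lemma polyfun_det m (Q : K -> 'M[K]_m) :
  (forall s t, polyfun 1 (fun x => Q x s t)) -> polyfun m (fun x => \det (Q x)).
Proof.
move=> pQ; apply: polyfun_sum => p.
apply: (@polyfunM 0 m); first exact: polyfun_const.
have := @polyfun_prod _ (index_enum 'I_m) _ _ (fun s => pQ s (p s)).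
by rewrite big_const_ord iter_addn_0 mul1n.
Qed.

Lemma polyfun_meval N k c (f : {mpoly K[N]}) (v : K -> 'I_N -> K) :
    f \is k.-homog -> (forall i, polyfun c (fun x => v x i)) ->
  polyfun (c * k) (fun x => f.@[v x]).
Proof.
move=> hf pv; apply: (@eq_polyfun _ (fun x => \sum_(m <- msupp f)
    (if m \in msupp f then f@_m * \prod_i v x i ^+ m i else 0))).
  move=> x; rewrite mevalE big_seq [RHS]big_seq.
  by apply: eq_bigr => m ->.
apply: polyfun_sum => m; case mf: (m \in msupp f); last exact: polyfun_const.
rewrite -[(c * k)%N]add0n; apply: polyfunM; first exact: polyfun_const.
rewrite -(dhomog_mf hf mf) /= mdegE. rewrite big_distrr /=.
by apply: (@polyfun_prod _ _ (fun i => c * m i)%N) => i; apply: polyfunX.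
Qed.

Lemma polyfun_eq0_seq c F (s : seq K) :
    uniq s -> (c < size s)%N -> polyfun c F -> {in s, forall x, F x = 0} ->
  forall x, F x = 0.
Proof.
move=> us lt_c [p sp pE] F0 x; rewrite pE; have [->|p0] := eqVneq p 0.
  by rewrite horner0.
have /(max_poly_roots p0)/(_ us) : all (root p) s.
  by apply/allP => y ys; rewrite /root -pE F0.
by move=> lt_p; have := leq_trans lt_p sp; rewrite ltnS leqNgt lt_c.
Qed.

Definition infinite_field : Prop := forall s : seq K, exists x, x \notin s.

Hypothesis infK : infinite_field.

Lemma infinite_uniq_seq m : exists2 s : seq K, uniq s & size s = m.
Proof.
elim: m => [|m [s us <-]]; first by exists [::].
by have [x xs] := infK s; exists (x :: s); rewrite /= ?xs.
Qed.

Lemma infinite_uniq_seq_avoid (r : seq K) m :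
  exists2 s : seq K, uniq s /\ size s = m & {in s, forall x, x \notin r}.
Proof.
elim: m => [|m [s [us <-] sr]]; first by exists [::].
have [x] := infK (s ++ r); rewrite mem_cat negb_or => /andP[xs xr].
exists (x :: s); first by rewrite /= xs.
by move=> y; rewrite inE => /predU1P[->|/sr].
Qed.

(** Density of a cofinite subset of a line; this is how limit points are reached in closures. *)
Lemma polyfun_eq0 c F (r : seq K) :
  polyfun c F -> (forall x, x \notin r -> F x = 0) -> forall x, F x = 0.
Proof.
move=> pF F0; have [s [us szs] sr] := infinite_uniq_seq_avoid r c.+1.
by apply: (polyfun_eq0_seq us _ pF); rewrite ?szs // => x /sr/F0.
Qed.

(** Irreducibility of the affine line: two nonempty open subsets meet. *)
Lemma polyfun_mul_neq0 c c' F G x y :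
    polyfun c F -> polyfun c' G -> F x != 0 -> G y != 0 ->
  exists z, F z * G z != 0.
Proof.
move=> [p sp pE] [q sq qE]; rewrite pE qE => px qy.
have pq0 : p * q != 0.
  rewrite mulf_neq0 //; [move: px|move: qy]; apply: contraNneq => ->;
  by rewrite horner0.
have [s us szs] := infinite_uniq_seq (size (p * q)).
have : ~~ all (root (p * q)) s.
  by apply/negP => /(max_poly_roots pq0)/(_ us); rewrite szs ltnn.
by case/allPn => z _; rewrite /root hornerM -pE -qE; exists z.
Qed.

Section Grid.

Variable J : finType.

Definition upd (x : {ffun J -> K}) j t : {ffun J -> K} :=
  [ffun i => if i == j then t else x i].

Definition sep_polyfun c (F : {ffun J -> K} -> K) : Prop :=
  forall x j, polyfun c (fun t => F (upd x j t)).

(** The coordinates are released from the grid one at a time; at each release a one-variable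
    polynomial of degree at most c has more than c roots. *)
Lemma sep_polyfun_grid c F (s : seq K) :
    uniq s -> (c < size s)%N -> sep_polyfun c F ->
    (forall x : {ffun J -> K}, (forall j, x j \in s) -> F x = 0) ->
  forall x, F x = 0.
Proof.
move=> us lt_c pF F0 x.
suff H (r : seq J) : forall x : {ffun J -> K}, (forall j,
  j \notin r -> x j \in s) -> F x = 0.
  by apply: (H (enum J)) => j; rewrite mem_enum.
elim: r => [|j r IHr] {}x xs; first by apply: F0 => j; apply: xs.
have -> : x = upd x j (x j) by apply/ffunP => i; rewrite ffunE; case: eqP =>
  [->|].
apply: (polyfun_eq0_seq us lt_c (pF x j)) => t ts; apply: IHr => i ir.
by rewrite ffunE; case: eqP => // /eqP ij; apply: xs; rewrite inE negb_or ij.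
Qed.

End Grid.

End PolynomialFunctions.

(** * Homogeneous forms and their directional derivatives *)

Section HomogeneousForms.

Local Open Scope ring_scope.

Variables (K : fieldType) (N : nat).

Implicit Types (f : {mpoly K[N]}) (v : 'I_N -> K).

Lemma dhomog_mevalZ k f c v :
  f \is k.-homog -> f.@[fun i => c * v i] = c ^+ k * f.@[v].
Proof.
move=> hf; rewrite !mevalE big_distrr /=; apply: eq_big_seq => m mf.
rewrite mulrCA; congr (_ * _); rewrite -(dhomog_mf hf mf) /= mdegE.
rewrite -prodrXr -big_split /=; apply: eq_bigr => i _; exact: exprMn.
Qed.

Lemma dhomog_meval_eq0 k f c v w :
    f \is k.-homog -> c != 0 -> (forall i, w i = c * v i) ->
  (f.@[w] == 0) = (f.@[v] == 0).
Proof.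
move=> hf c0 wE; rewrite (meval_eq _ wE) (dhomog_mevalZ _ _ hf).
by rewrite mulf_eq0 expf_eq0 (negbTE c0) andbF.
Qed.

Lemma dhomog_XU i : 'X_i \is [in K[N], 1.-homog].
Proof. by rewrite dhomogX /= mdeg1. Qed.

Lemma mderivXU (i j : 'I_N) : 'X_j^`M(i) = (i == j)%:R :> {mpoly K[N]}.
Proof.
rewrite mderivX mnm1E eq_sym; case: eqP => [->|_]; last by rewrite scale0r.
rewrite scale1r (_ : _ - _ = 0)%MM ?mpolyX0 //.
by apply/mnmP => l; rewrite mnmBE subnn mnm0E.
Qed.

(** The derivative is the formal one, hence valid in every characteristic. The property [Q] holds
    for constants and variables and is stable under sums and products. *)
Lemma meval_directional_deriv f v w : exists2 p : {poly K},
  forall s, f.@[fun i => v i + s * w i] = p.[s] &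
  p^`().[0] = \sum_i (f^`M(i)).@[v] * w i.
Proof.
pose Q g := exists2 p : {poly K},
  forall s, g.@[fun i => v i + s * w i] = p.[s] &
  p^`().[0] = \sum_i (g^`M(i)).@[v] * w i.
have p0 (p : {poly K}) (g : {mpoly K[N]}) :
    (forall s, g.@[fun i => v i + s * w i] = p.[s]) -> p.[0] = g.@[v].
  by move=> <-; apply: meval_eq => i; rewrite mul0r addr0.
have QC c : Q c%:MP.
  exists c%:P => [s|]; first by rewrite mevalC hornerC.
  rewrite derivC horner0 big1 // => i _.
  by rewrite mderivC meval0 mul0r.
have QX j : Q 'X_j.
  exists ((v j)%:P + w j *: 'X) => [s|];
    first by rewrite mevalXU !hornerE mulrC.
  rewrite derivD derivC derivZ derivX !hornerE (bigD1 j) //= big1 ?addr0.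
    by rewrite mderivXU eqxx meval1 mul1r.
  by move=> i ij; rewrite mderivXU (negbTE ij) meval0 mul0r.
have QD g h : Q g -> Q h -> Q (g + h).
  move=> [p pE dp] [q qE dq]; exists (p + q) => [s|].
    by rewrite mevalD pE qE hornerD.
  rewrite derivD hornerD dp dq -big_split; apply: eq_bigr => i _ /=.
  by rewrite mderivD mevalD mulrDl.
have QM g h : Q g -> Q h -> Q (g * h).
  move=> [p pE dp] [q qE dq]; exists (p * q) => [s|].
    by rewrite mevalM pE qE hornerM.
  rewrite derivM hornerD !hornerM dp dq (p0 p g) // (p0 q h) //.
  rewrite mulr_suml mulr_sumr -big_split; apply: eq_bigr => i _ /=.
  by rewrite mderivM mevalD !mevalM mulrDl mulrAC mulrA.
rewrite -/(Q f) (mpolyE f).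
elim/big_ind: _ => [|//|m _]; first by rewrite -mpolyC0.
rewrite -mul_mpolyC mpolyXE_id; apply: (QM _ _ (QC _)).
elim/big_ind: _ => [|//|i _]; first by rewrite -mpolyC1.
by elim: (m i) => [|k IHk]; rewrite ?expr0 -?mpolyC1 // exprS; apply: QM.
Qed.

End HomogeneousForms.

(** * Equations of Schubert varieties *)

Section ZariskiClosure.

Local Open Scope ring_scope.

Variables (K : fieldType) (n d : nat).

Implicit Types (Y Z : {vspace 'cV[K]_n} -> Prop).

(** The set cut out by all forms vanishing on Y is itself closed and contains Y, so it is the
    smallest such set. *)
Lemma zclosureP Y U : subpt Y (grass d) ->
  zclosure d Y U <-> grass d U /\
    forall k (f : {mpoly K[#|Idn n d|]}), f \is k.-homog ->
      (forall V, Y V -> f.@[plucker V] = 0) -> f.@[plucker U] = 0.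
Proof.
move=> gY; split=> [YU|[gU YU] Z [F hF ZE] YZ].
  suff [gU FU] : grass d U /\ forall f : {mpoly K[#|Idn n d|]},
      ((exists k, f \is k.-homog) /\ forall V, Y V -> f.@[plucker V] = 0) ->
      f.@[plucker U] = 0.
    by split=> // k f hf fY; apply: FU; split=> //; exists k.
  apply: (YU (fun U => grass d U /\ forall f : {mpoly K[#|Idn n d|]},
      ((exists k, f \is k.-homog) /\ forall V, Y V -> f.@[plucker V] = 0) ->
      f.@[plucker U] = 0)).
    exists (fun f => (exists k, f \is k.-homog) /\
                     forall V, Y V -> f.@[plucker V] = 0) => //.
    by move=> f [].
  by move=> V YV; split=> [|f [_ fY]]; [apply: gY | apply: fY].
apply/ZE; split=> // f Ff; have [k hf] := hF f Ff.
by apply: YU hf _ => V /YZ /ZE[_]; apply.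
Qed.

Lemma zclosed_zclosure Y : subpt Y (grass d) -> zclosed d (zclosure d Y).
Proof.
move=> gY; exists (fun f => (exists k, f \is k.-homog) /\
                            forall V, Y V -> f.@[plucker V] = 0).
  by move=> f [].
move=> U; split=> [/(zclosureP _ gY)[gU YU]|[gU YU]].
  by split=> // f [[k hf]]; apply: YU hf.
by apply/(zclosureP _ gY); split=> // k f hf fY; apply: YU; split=> //;
  exists k.
Qed.

Lemma sub_zclosure Y : subpt Y (zclosure d Y).
Proof. by move=> U YU Z _; apply. Qed.

Lemma zclosure_min Y Z : zclosed d Z -> subpt Y Z -> subpt (zclosure d Y) Z.
Proof. by move=> cZ YZ U; apply. Qed.

Lemma zclosureS Y Z : subpt Y Z -> subpt (zclosure d Y) (zclosure d Z).
Proof. by move=> YZ U YU T cT ZT; apply: YU cT _ => V /YZ/ZT. Qed.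

Lemma zclosed_form k (f : {mpoly K[#|Idn n d|]}) : f \is k.-homog ->
  zclosed d (fun U => grass d U /\ f.@[plucker U] = 0).
Proof.
move=> hf; exists (eq f) => [_ <-|U]; first by exists k.
by split=> -[gU]; [move=> fU; split=> // _ <-|move=> /(_ f erefl)].
Qed.

Lemma zclosed_grass Z : zclosed d Z -> subpt Z (grass d).
Proof. by case=> F _ ZE U /ZE[]. Qed.

Lemma meval_plucker_cspan k (f : {mpoly K[#|Idn n d|]}) (M : 'M[K]_(n, d)) :
    f \is k.-homog -> row_full M ->
  (f.@[plucker (cspan M)] == 0) = (f.@[minors M] == 0).
Proof.
move=> hf /plucker_cspan[c c0 cE].
exact: dhomog_meval_eq0 hf c0 cE.
Qed.

Lemma row_full_mull (g : 'M[K]_n) (M : 'M[K]_(n, d)) :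
  g \in unitmx -> row_full M -> row_full (g *m M).
Proof.
move=> ug /row_fullP[B BM]; apply/row_fullP; exists (B *m invmx g).
by rewrite -mulmxA (mulmxA _ g) mulVmx // mul1mx.
Qed.

Lemma mul_coord_mx (g : 'M[K]_n) (h : 'I_d -> 'I_n) i t :
  (g *m coord_mx K h) i t = g i (h t).
Proof.
rewrite mxE (bigD1 (h t)) //= mxE eqxx mulr1 big1 ?addr0 // => j jh.
by rewrite mxE (negbTE jh) mulr0.
Qed.

Lemma cspan_coord_mx_perm (g h : 'I_d -> 'I_n) (p : 'S_d) :
  (forall t, g t = h (p t)) -> cspan (coord_mx K g) = cspan (coord_mx K h).
Proof.
move=> gE; rewrite -(@cspan_mulr _ _ _ (coord_mx K h) (perm_mx p^-1)).
  congr (cspan _); apply/matrixP => i t; rewrite -col_permE !mxE gE.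
  by [].
exact: unitmx_perm.
Qed.

End ZariskiClosure.

(* The Borel subgroup and its opposite are both the group of matrices that are
   triangular for a total order on the indices, encoded by an injective rank
   function. *)
Section SchubertEquations.

Local Open Scope ring_scope.

Variables (K : fieldType) (n d : nat).
Hypothesis infK : infinite_field K.
Hypothesis d_lt_n : (d < n)%N.

Variable r : 'I_n -> nat.
Hypothesis injr : injective r.

Implicit Types (h : 'I_d -> 'I_n) (M : 'M[K]_(n, d)).

Definition rank_borel (g : 'M[K]_n) : Prop :=
  \det g = 1 /\ forall i j, g i j != 0 -> (r i <= r j)%N.

(** Order on I_{d,n} induced by r. It is phrased with a matching because h is unsorted and r may
    reverse the order of the rows. *)
Definition rank_le (k : 'I_#|Idn n d|) h : Prop :=
  exists p : 'S_d, forall t, (r (idx k (p t)) <= r (h t))%N.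

(** Pivots of a column echelon form for the order r. *)
Definition leading M h : Prop :=
  (forall t, M (h t) t != 0) /\ forall i t, M i t != 0 -> (r i <= r (h t))%N.

Lemma det_leading M h : injective h -> leading M h -> \det (rowsub h M) != 0.
Proof.
move=> injh [Mh leM]; rewrite (@det_trig_rank _ _ _ (r \o h)).
- by apply/prodf_neq0 => t _; rewrite mxE.
- exact: inj_comp.
by move=> s t; rewrite mxE => /leM.
Qed.

Lemma leading_full M h : injective h -> leading M h -> row_full M.
Proof.
move=> injh /(det_leading injh) /det_rowsub_neq0[k [p [_]]].
exact: row_full_minors.
Qed.

(** The columns of M are placed in g at the positions [h t], and unit vectors elsewhere. Since d <
    n, some position [j0] is missed by h; its diagonal entry is free and is used to normalise the
    determinant to 1. *)
Lemma rank_borel_orbit M h : injective h -> leading M h ->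
  exists2 g, rank_borel g & cspan M = Defs.act g (cspan (coord_mx K h)).
Proof.
move=> injh [Mh leM].
have [j0 j0h] : exists j, j \notin codom h.
  apply/existsP; apply: contraTT d_lt_n => /existsPn all_h.
  rewrite -leqNgt -[X in (X <= _)%N]card_ord -[X in (_ <= X)%N]card_ord.
  rewrite -(card_codom injh); apply/subset_leq_card/subsetP => j _.
  exact/negPn/all_h.
pose B0 i j := if [pick t | h t == j] is Some t then M i t else (i == j)%:R.
pose D := \prod_(j | j != j0) B0 j j.
pose g := \matrix_(i, j) if j == j0 then (i == j)%:R * D^-1 else B0 i j.
have B0h i t : B0 i (h t) = M i t.
  rewrite /B0; case: pickP => [s /eqP/injh->//|/(_ t)].
  by rewrite eqxx.
have B0_trig i j : B0 i j != 0 -> (r i <= r j)%N.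
  rewrite /B0; case: pickP => [s /eqP<-|_]; first exact: leM.
  by case: (i =P j) => [->|]; rewrite ?eqxx.
have D0 : D != 0.
  apply/prodf_neq0 => j _; rewrite /B0.
  by case: pickP => [s /eqP<-//|_]; rewrite eqxx oner_eq0.
have g_trig i j : g i j != 0 -> (r i <= r j)%N.
  rewrite mxE; case: ifP => [_|_]; last exact: B0_trig.
  by case: (i =P j) => [->|]; rewrite // mul0r eqxx.
exists g; first split=> //.
  rewrite (det_trig_rank injr g_trig) (bigD1 j0) //= mxE !eqxx mul1r.
  rewrite (eq_bigr (fun j => B0 j j)) ?mulVf // => j jj0.
  by rewrite mxE (negbTE jj0).
rewrite act_cspan; congr cspan; apply/matrixP => i t.
rewrite mul_coord_mx mxE B0h; case: eqP => // htj0.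
by case/codomP: j0h; exists t.
Qed.

Lemma rank_borel_support g h k : injective h -> rank_borel g ->
    plucker (Defs.act g (cspan (coord_mx K h))) k != 0 ->
  rank_le k h.
Proof.
move=> injh [det_g trig_g]; rewrite act_cspan plucker_cspan_eq0; last first.
  apply: row_full_mull; last exact: coord_mx_full.
  by rewrite unitmxE det_g unitr1.
case/det_neq0_perm => p nz; exists p^-1%g => t.
by have := nz (p^-1%g t); rewrite mxE mul_coord_mx permKV => /trig_g.
Qed.

(* If the echelon basis [M] of U has pivots below [h], then [M + s E_h] spans a
   point of the orbit for all but finitely many s, and U is the point s = 0. *)
Lemma zclosure_rank_borel_orbit h U : injective h ->
    (forall M, row_full M -> exists2 C, C \in unitmx &
       exists2 b, injective b & leading (M *m C) b) ->
  zclosure d (fun V => exists2 g, rank_borel g &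
                         V = Defs.act g (cspan (coord_mx K h))) U <->
  grass d U /\ forall k : 'I_#|Idn n d|, plucker U k != 0 -> rank_le k h.
Proof.
move=> injh ech; set Y := fun V => _.
have gY : subpt Y (grass d).
  move=> V [g [det_g _] ->]; rewrite act_cspan; apply/dim_cspan/row_full_mull.
    by rewrite unitmxE det_g unitr1.
  exact: coord_mx_full.
split=> [YU|[gU supU]].
  split=> [|k Uk]; first by have [] := (zclosureP U gY).1 YU.
  apply: NNPP => nle; case/eqP: Uk.
  have [_ /(_ 1%N 'X_k (dhomog_XU _ _))] := (zclosureP U gY).1 YU.
  rewrite mevalXU; apply=> V [g bg ->]; rewrite mevalXU; apply/eqP/negPn/negP.
  by move/(rank_borel_support injh bg).
apply/(zclosureP _ gY); split=> // e f hf fY.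
have [C uC [b injb]] := ech _ (row_full_basis_mx gU); set M := _ *m C => lead_M.
have UE : cspan M = U by rewrite cspan_mulr // cspan_basis_mx.
have fM : row_full M := leading_full injb lead_M.
have [k [p [bE Mk]]] := det_rowsub_neq0 (det_leading injb lead_M).
have [q le_q] : rank_le k h by apply: supU; rewrite -UE plucker_cspan_eq0.
(* A reordering of h, composed from the matchings p and q, which puts above each pivot [b t] an
   entry of h that dominates it. *)
pose h' t := h ((p * q^-1)%g t).
have injh' : injective h' by apply: inj_comp injh _; apply: perm_inj.
have le_b t : (r (b t) <= r (h' t))%N.
  by rewrite bE -{1}(permKV q (p t)) /h' permM; apply: le_q.
pose N s := M + s *: coord_mx K h'.
have NE s i t : N s i t = M i t + s * (i == h' t)%:R by rewrite !mxE.
(* The excluded parameters are those that cancel the entry in row [h' t] of some column. *)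
have lead_N s : s \notin [seq - M (h' t) t | t : 'I_d] -> leading (N s) h'.
  move=> sM; split=> [t|i t].
    rewrite NE eqxx mulr1; apply: contra sM => /eqP/addr0_eq <-.
    by apply/imageP; exists t.
  rewrite NE; case: (i =P h' t) => [->|_] //; rewrite mulr0 addr0.
  by move/(proj2 lead_M)/leq_trans; apply.
have fN0 s : f.@[minors (N s)] = 0.
  apply: (polyfun_eq0 infK (c := (d * e)%N) (r := [seq - M (h' t) t | t : 'I_d])
           (F := fun s => f.@[minors (N s)])) => [|{}s /lead_N lead_s].
    apply: polyfun_meval hf _ => l; apply: polyfun_det => u t.
    apply: eq_polyfun (polyfun_affine (M (idx l u) t) (idx l u == h' t)%:R) =>
      x.
    by rewrite [RHS]mxE NE.
  apply/eqP; rewrite -(meval_plucker_cspan hf) ?(leading_full injh') //.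
  apply/eqP/fY; have [g bg ->] := rank_borel_orbit injh' lead_s.
  by exists g => //; rewrite (@cspan_coord_mx_perm _ _ _ h' h (p * q^-1)%g).
apply/eqP; rewrite -UE (meval_plucker_cspan hf) //.
by rewrite -[X in minors X]addr0 -(scale0r (coord_mx K h')) fN0.
Qed.

End SchubertEquations.

(** * Chains of irreducible closed sets *)

Section Irreducibility.

Local Open Scope ring_scope.

Variables (K : fieldType) (n d : nat).
Hypothesis infK : infinite_field K.

Implicit Types (Y Z : {vspace 'cV[K]_n} -> Prop) (M : 'M[K]_(n, d)).

Definition family (L : 'M[K]_(n, d) -> Prop) (U : {vspace 'cV[K]_n}) : Prop :=
  exists M, [/\ L M, row_full M & U = cspan M].

Lemma family_grass L : subpt (family L) (grass d).
Proof. by move=> _ [M [_ fM ->]]; apply: dim_cspan. Qed.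

Lemma polyfun_minors_line M1 M2 k : polyfun d (fun s =>
  minors (M1 + s *: M2) k).
Proof.
apply: polyfun_det => u t.
by apply: eq_polyfun (polyfun_affine (M1 (idx k u) t) (M2 (idx k u) t)) => x;
  rewrite !mxE.
Qed.

(** If a form [f1] is nonzero at M1 and [f2] at M2, the line through M1 and M2 stays in L and
    contains a point where neither vanishes, which lies in neither closed set. *)
Lemma family_irreducible (L : 'M[K]_(n, d) -> Prop) :
    (exists U, family L U) ->
    (forall M1 M2 s, L M1 -> L M2 -> L (M1 + s *: (M2 - M1))) ->
  zirreducible d (zclosure d (family L)).
Proof.
move=> [U0 LU0] lineL; split; first by exists U0; apply: sub_zclosure.
move=> Z1 Z2 cZ1 cZ2 sub12.
have [sub1|nsub1] := classic (subpt (family L) Z1).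
  by left; apply: zclosure_min.
right; apply: zclosure_min => // _ [M2 [LM2 fM2 ->]].
have [U1 nU1] := not_all_ex_not _ _ nsub1.
have [[M1 [LM1 fM1 UE1]] nZ1] := imply_to_and _ _ nU1; rewrite {}UE1 in nZ1 *.
have [F1 hF1 Z1E] := cZ1; have [F2 hF2 Z2E] := cZ2.
have [f1 Ff1 f1M1] : exists2 f1, F1 f1 & f1.@[minors M1] != 0.
  apply: NNPP => no; apply: nZ1; apply/Z1E; split; first exact: dim_cspan.
  move=> f Ff; have [k hf] := hF1 f Ff; apply/eqP.
  rewrite (meval_plucker_cspan hf) //; apply/negPn/negP => nz; apply: no.
  by exists f.
apply/Z2E; split=> [|f2 Ff2]; first exact: dim_cspan.
have [k1 hf1] := hF1 _ Ff1; have [k2 hf2] := hF2 _ Ff2.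
apply/eqP; rewrite (meval_plucker_cspan hf2) //; apply/negPn/negP => f2M2.
have [k M1k] := elimT (row_full_minorsP M1) fM1.
pose N s := M1 + s *: (M2 - M1).
have N0 : N 0 = M1 by rewrite /N scale0r addr0.
have N1 : N 1 = M2 by rewrite /N scale1r addrC subrK.
have pN l : polyfun d (fun s => minors (N s) l) by apply: polyfun_minors_line.
have p1 := polyfun_meval hf1 pN; have p2 := polyfun_meval hf2 pN.
(* The minor at k is carried along so that the point found still has full rank. *)
have [y f1k_y] : exists y, f1.@[minors (N y)] * minors (N y) k != 0.
  by apply: (polyfun_mul_neq0 infK p1 (pN k) (x := 0) (y := 0)); rewrite N0.
have [z] : exists z, f1.@[minors (N z)] * minors (N z) k * f2.@[minors (N z)]
  != 0.
  apply: (polyfun_mul_neq0 infK (polyfunM p1 (pN k)) p2 f1k_y (y := 1)).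
  by rewrite N1.
rewrite !mulf_eq0 !negb_or => /andP[/andP[f1z kz] f2z].
have fN : row_full (N z) by apply: row_full_minors kz.
have : zclosure d (family L) (cspan (N z)).
  by apply: sub_zclosure; exists (N z); split=> //; apply: lineL.
case/sub12 => [/Z1E[_ /(_ f1 Ff1)]|/Z2E[_ /(_ f2 Ff2)]] /eqP.
  by rewrite (meval_plucker_cspan hf1) // (negbTE f1z).
by rewrite (meval_plucker_cspan hf2) // (negbTE f2z).
Qed.

(** Primality of the homogeneous ideal; it allows cancellation on the members of a chain. *)
Lemma zirreducible_mul_eq0 Z k l (f g : {mpoly K[#|Idn n d|]}) :
    zclosed d Z -> zirreducible d Z -> f \is k.-homog -> g \is l.-homog ->
    (forall U, Z U -> (f * g).@[plucker U] = 0) ->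
  (forall U, Z U -> f.@[plucker U] = 0) \/ (forall U,
    Z U -> g.@[plucker U] = 0).
Proof.
move=> cZ [_ irrZ] hf hg fg0.
have [|fZ|gZ] := irrZ _ _ (zclosed_form hf) (zclosed_form hg).
- move=> U ZU; have gU := zclosed_grass cZ ZU; move: (fg0 U ZU) => /eqP.
  by rewrite mevalM mulf_eq0 => /orP[] /eqP z0; [left|right].
- by left=> U /fZ[].
- by right=> U /gZ[].
Qed.

End Irreducibility.

(** * Forms separating the members of a chain, and their independent monomials *)

Section ChainForms.

Local Open Scope ring_scope.

Variables (K : fieldType) (n d : nat).

Variables (X : {vspace 'cV[K]_n} -> Prop) (x : {vspace 'cV[K]_n}) (m : nat).
Variable Z : nat -> {vspace 'cV[K]_n} -> Prop.
Hypothesis chainZ : chain_at d X x m Z.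

Local Notation form := {mpoly K[#|Idn n d|]}.

Lemma chain_mono i : (i < m)%N -> subpt (Z i) (Z i.+1).
Proof. by move=> im; have [_ /(_ i im)[]] := chainZ. Qed.

Lemma chain_point i : (i <= m)%N -> Z i x.
Proof. by move=> im; have [/(_ i im)[]] := chainZ. Qed.

(** Separating forms come with various degrees. They are raised to a common degree by powers of a
    coordinate nonzero at x; as x lies on every irreducible [Z i.+1], that factor does not make them
    vanish there. *)
Lemma chain_separating_forms : exists (k : nat) (f0 : form) (f : 'I_m -> form),
  [/\ f0 \is k.-homog, forall i, f i \is k.-homog, f0.@[plucker x] != 0,
      forall (i : 'I_m) U, Z i U -> (f i).@[plucker U] = 0
    & forall i : 'I_m, ~ forall U, Z i.+1 U -> (f i).@[plucker U] = 0].
Proof.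
have [irrZ strictZ] := chainZ.
have gx : grass d x by have [cZ _ _ Zx] := irrZ 0%N isT;
  exact: zclosed_grass cZ _ Zx.
have [l xl] : exists l : 'I_#|Idn n d|, plucker x l != 0.
  rewrite -(cspan_basis_mx gx); have fB := row_full_basis_mx gx.
  have /row_full_minorsP[l Bl] := fB; exists l.
  by rewrite plucker_cspan_eq0.
have /fin_all_exists[kg kgP] (i : 'I_m) : exists kg : nat * form,
    [/\ kg.2 \is (kg.1).-homog, forall U, Z i U -> kg.2.@[plucker U] = 0
      & ~ forall U, Z i.+1 U -> kg.2.@[plucker U] = 0].
  have [cZ _ _ _] := irrZ i (ltnW (ltn_ord i)).
  have [cZ1 _ _ _] := irrZ i.+1 (ltn_ord i).
  have [_ nsub] := strictZ i (ltn_ord i).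
  have [U nU] := not_all_ex_not _ _ nsub; have [ZU nZU] := imply_to_and _ _ nU.
  have [F hF ZE] := cZ.
  have [f Ff fU] : exists2 f, F f & f.@[plucker U] <> 0.
    apply: NNPP => no; apply: nZU; apply/ZE; split.
      exact: zclosed_grass cZ1 _ ZU.
    by move=> f Ff; apply: NNPP => fU; apply: no; exists f.
  have [k hf] := hF f Ff; exists (k, f); split=> //= [V /ZE[_]|]; first exact.
  by move/(_ U ZU).
(* Any common upper bound of the degrees would do; the sum is one. *)
pose k := (\sum_i (kg i).1)%N.
have le_k i : ((kg i).1 <= k)%N by rewrite /k (bigD1 i) //= leq_addr.
have hX j : 'X_l ^+ j \is [in K[#|Idn n d|], j.-homog].
  by have := dhomogMn j (dhomog_XU K l); rewrite mul1n.
exists k, ('X_l ^+ k), (fun i => (kg i).2 * 'X_l ^+ (k - (kg i).1)).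
split=> // [i||i U ZU|i].
- have [hg _ _] := kgP i; rewrite -{2}(subnKC (le_k i)).
  exact: dhomogM hg (hX _).
- by rewrite rmorphXn /= mevalXU expf_neq0.
- by have [_ gZ _] := kgP i; rewrite mevalM gZ // mul0r.
have [hg _ ng] := kgP i; have [cZ1 iZ1 _ Zx] := irrZ i.+1 (ltn_ord i).
case/(zirreducible_mul_eq0 cZ1 iZ1 hg (hX _)) => // /(_ x Zx) /eqP.
by rewrite rmorphXn /= mevalXU expf_eq0 (negbTE xl) andbF.
Qed.

Variables (k : nat) (f0 : form) (f : 'I_m -> form) (D : nat).
Hypotheses (hf0 : f0 \is k.-homog) (hf : forall i, f i \is k.-homog).
Hypothesis f0x : f0.@[plucker x] != 0.
Hypothesis fZ : forall (i : 'I_m) U, Z i U -> (f i).@[plucker U] = 0.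
Hypothesis fZ1 : forall i : 'I_m, ~ forall U,
  Z i.+1 U -> (f i).@[plucker U] = 0.

Local Notation expo := {ffun 'I_m -> 'I_D.+1}.

(** The power of [f0] homogenises, giving all monomials the same degree. The truncation at j serves
    the descent: on [Z j] only the forms of index below j still matter. *)
Definition chain_mon (j : nat) (e : expo) : form :=
  f0 ^+ (m * D - \sum_(i : 'I_m | (i < j)%N) e i) * \prod_(i : 'I_m |
    (i < j)%N) f i ^+ e i.

Lemma sum_expo_le (e : expo) j : (\sum_(i : 'I_m | (i < j)%N) e i <= m * D)%N.
Proof.
rewrite -[X in (_ <= X * _)%N]card_ord -sum_nat_const.
rewrite big_mkcond leq_sum // => i _; case: ifP => // _.
by rewrite -ltnS.
Qed.

Lemma dhomog_prod_expo (e : expo) j :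
  \prod_(i : 'I_m | (i < j)%N) f i ^+ e i \is (k * \sum_(i : 'I_m |
    (i < j)%N) e i).-homog.
Proof.
elim/big_rec2: _ => [|i y p _ IH]; first by rewrite muln0 dhomog1.
by rewrite mulnDr; apply: dhomogM IH; apply: dhomogMn.
Qed.

Lemma chain_mon_homog j e : chain_mon j e \is (k * (m * D)).-homog.
Proof.
rewrite -{1}(subnK (sum_expo_le e j)) mulnDr.
by apply: dhomogM; [apply: dhomogMn | apply: dhomog_prod_expo].
Qed.

(* Descending along the chain: on Z_(j+1) the smallest power of f_j can be
   divided out, and the restriction to Z_j kills all larger powers. *)
Lemma chain_mon_free (c : expo -> K) :
    (forall U, Z m U -> \sum_e c e * (chain_mon m e).@[plucker U] = 0) ->
  forall e, c e = 0.
Proof.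
move=> c0 e0; apply/eqP/negPn/negP => ce0.
have [irrZ _] := chainZ.
(* Invariant: on [Z (m - l)] there is a relation with nonzero coefficients among truncated
   monomials, whose exponents all agree from position m - l on. *)
have descent l : (l <= m)%N -> exists S : {set expo},
   [/\ S != set0, forall e, e \in S -> c e != 0,
       forall e e' (i : 'I_m), e \in S -> e' \in S -> (m - l <= i)%N -> e i =
         e' i
     & forall U, Z (m - l) U ->
         \sum_(e in S) c e * (chain_mon (m - l) e).@[plucker U] = 0].
  elim: l => [_|l IHl lt_lm].
    exists [set e | c e != 0]; split=> [|e|e e' i _ _|U].
    - by apply/set0Pn; exists e0; rewrite inE.
    - by rewrite inE.
    - by rewrite subn0 leqNgt ltn_ord.
    rewrite subn0 => /c0 c0U; rewrite -[RHS]c0U big_mkcond; apply: eq_bigr =>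
      e _.
    by rewrite inE; case: eqP => // ->; rewrite mul0r.
  have [S [/set0Pn[e1 Se1] cS agS S0]] := IHl (ltnW lt_lm).
  set j := (m - l.+1)%N; have jE : (m - l = j.+1)%N by rewrite /j subnSK.
  have jm : (j < m)%N by rewrite -jE leq_subr.
  rewrite jE in agS S0; pose oj := Ordinal jm.
  case: (@arg_minnP _ e1 (mem S) (fun e => e oj) Se1) => e2 Se2 min_e2.
  have {}Se2 : e2 \in S by [].
  set mu := e2 oj in min_e2.
  have sumE (e : expo) : (\sum_(i : 'I_m | (i < j.+1)%N) e i =
                 e oj + \sum_(i : 'I_m | (i < j)%N) e i)%N.
    rewrite (bigD1 oj) //=; congr addn; apply: eq_bigl => i.
    by rewrite ltnS -val_eqE /= [RHS]ltn_neqAle andbC.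
  have prodE (e : expo) : \prod_(i : 'I_m | (i < j.+1)%N) f i ^+ e i =
                 f oj ^+ e oj * \prod_(i : 'I_m | (i < j)%N) f i ^+ e i.
    rewrite (bigD1 oj) //=; congr (_ * _); apply: eq_bigl => i.
    by rewrite ltnS -val_eqE /= [RHS]ltn_neqAle andbC.
  (* The monomial with the common power [mu] of the form of index j divided out. *)
  pose T (e : expo) : form := f0 ^+ (m * D - \sum_(i : 'I_m |
    (i < j.+1)%N) e i) *
     (f oj ^+ (e oj - mu) * \prod_(i : 'I_m | (i < j)%N) f i ^+ e i).
  have TE e : e \in S -> chain_mon j.+1 e = f oj ^+ mu * T e.
    move=> Se; rewrite /chain_mon prodE /T [RHS]mulrCA; congr (_ * _).
    by rewrite [RHS]mulrA -exprD subnKC // min_e2.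
  have hT e : e \in S -> T e \is (k * (m * D - mu)).-homog.
    move=> Se; have le_mu := min_e2 e Se.
    have -> : (m * D - mu = (m * D - \sum_(i : 'I_m | (i < j.+1)%N) e i) +
       ((e oj - mu) + \sum_(i : 'I_m | (i < j)%N) e i))%N.
      have := sum_expo_le e j.+1; rewrite sumE.
      move: (\sum_(i : 'I_m | (i < j)%N) e i)%N le_mu => y.
      move: (nat_of_ord mu) (nat_of_ord (e oj)) (m * D)%N => a b b'; lia.
    rewrite !mulnDr; apply: dhomogM; first exact: dhomogMn.
    by apply: dhomogM; [apply: dhomogMn | apply: dhomog_prod_expo].
  pose G := \sum_(e in S) c e *: T e.
  have hG : G \is (k * (m * D - mu)).-homog.
    by apply: rpred_sum => e Se; apply: rpredZ; apply: hT.
  have [cZ1 iZ1 _ _] := irrZ j.+1 jm.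
  have G0 U : Z j.+1 U -> G.@[plucker U] = 0.
    have [||GZ] := zirreducible_mul_eq0 cZ1 iZ1 (dhomogMn mu (hf oj)) hG.
    - move=> V ZV; rewrite /G mulr_sumr raddf_sum /= -[RHS](S0 V ZV).
      by apply: eq_bigr => e Se; rewrite -scalerAr mevalZ TE.
    - move=> fmu0; case: (fZ1 (i := oj)) => V /fmu0 /eqP.
      by rewrite rmorphXn expf_eq0 => /andP[_ /eqP].
    exact: GZ.
  exists [set e in S | e oj == mu]; split=> [|e|e e' i|U ZU].
  - by apply/set0Pn; exists e2; rewrite inE Se2 eqxx.
  - by rewrite inE => /andP[/cS].
  - rewrite !inE => /andP[Se /eqP ej] /andP[Se' /eqP ej'].
    rewrite leq_eqVlt => /predU1P[ji|]; last exact: agS.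
    have -> : i = oj by apply: val_inj.
    by rewrite ej ej'.
  (* Dividing out the power [mu] left the degree short; multiplying by the same power of [f0]
     restores the exponent of [f0] prescribed by [chain_mon j]. *)
  have := G0 U (chain_mono jm ZU); move/(congr1 (fun a =>
    f0.@[plucker U] ^+ mu * a)).
  rewrite mulr0 /G raddf_sum /= mulr_sumr => G0U; rewrite -[RHS]G0U.
  rewrite [RHS](bigID (fun e : expo => e oj == mu)) /= [X in _ = _ + X]big1.
    rewrite addr0; apply: eq_big => [e|e]; first by rewrite inE.
    rewrite inE => /andP[Se /eqP ej]; rewrite mevalZ mulrCA; congr (_ * _).
    rewrite /T ej subnn expr0 mul1r /chain_mon !mevalM mulrA !rmorphXn /=
      -exprD.
    congr (_ ^+ _ * _); have := sum_expo_le e j.+1; rewrite sumE ej.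
    by rewrite -/j; move: (\sum_(i : 'I_m | _) _)%N => y; lia.
  move=> e /andP[Se ej]; have lt_ej : (mu < e oj)%N.
    by rewrite ltn_neqAle min_e2 // andbT eq_sym.
  rewrite /T mevalZ !mevalM !rmorphXn /= (fZ (i := oj) ZU) expr0n subn_eq0.
  by rewrite leqNgt lt_ej mul0r !mulr0.
(* At the bottom all exponents agree, so one term is left: a nonzero coefficient times a power of
   [f0], which does not vanish at x. *)
have [S [/set0Pn[e1 Se1] cS agS S0]] := descent m (leqnn m).
rewrite subnn in agS S0.
have SE : S = [set e1].
  apply/setP => e; rewrite inE; apply/idP/eqP => [Se|->//].
  by apply/ffunP => i; apply: agS.
have := S0 x (chain_point (leq0n m)).
rewrite SE big_set1 /chain_mon !big_pred0 // mulr1 => /eqP.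
by rewrite rmorphXn mulf_eq0 (negbTE (cS _ Se1)) expf_eq0 (negbTE f0x) andbF.
Qed.

End ChainForms.

(** * Bounding the length of a chain by the number of parameters *)

Section ChainLength.

Local Open Scope ring_scope.

Variables (K : fieldType) (n d : nat).
Hypothesis infK : infinite_field K.

(* The monomials of degree at most [D] in each of the [m] separating forms are
   free on [Z m], but restrict to each piece as polynomials in at most [N]
   variables whose degrees are linear in [D], hence are determined by their
   values on a grid of size O(D^N). *)
Lemma chain_length_le (X : {vspace 'cV[K]_n} -> Prop) (x : {vspace 'cV[K]_n})
    (m N : nat) (Z : nat -> {vspace 'cV[K]_n} -> Prop) (P J : finType)
    (Psi : P -> {ffun J -> K} -> 'M[K]_(n, d)) (S : P -> {set J}) :
    (forall p i t y j, polyfun 1 (fun s => Psi p (upd y j s) i t)) ->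
    (forall p (y y' : {ffun J -> K}), (forall j,
      j \in S p -> y j = y' j) -> Psi p y = Psi p y') ->
    (forall p, #|S p| <= N)%N ->
    (forall U, X U -> exists p y, row_full (Psi p y) /\ U = cspan (Psi p y)) ->
    chain_at d X x m Z ->
  (m <= N)%N.
Proof.
move=> polyPsi eqPsi cardS XPsi chainZ.
have [k [f0 [f [hf0 hf f0x fZ fZ1]]]] := chain_separating_forms chainZ.
suff key D : (D.+1 ^ m <= #|P| * (d * (k * (m * D))).+1 ^ N)%N.
  rewrite leqNgt; apply/negP => lt_Nm.
  (* With this D the bound reads (D+1)^m <= D (D+1)^N, which is absurd once m > N. *)
  pose C := (d * (k * m)).+1; pose D := (#|P| * C ^ N)%N.
  have le_C : ((d * (k * (m * D))).+1 <= C * D.+1)%N.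
    by rewrite /C !mulnA mulSn mulnS; lia.
  have le_CN : ((d * (k * (m * D))).+1 ^ N <= (C * D.+1) ^ N)%N.
    by case: (N) => // N'; rewrite leq_exp2r.
  have := leq_trans (key D) (leq_mul (leqnn _) le_CN).
  rewrite expnMn mulnA -/D leqNgt => /negP; apply.
  apply: leq_trans (leq_pexp2l _ lt_Nm) => //.
  by rewrite expnS ltn_pmul2r ?expn_gt0.
rewrite leqNgt; apply/negP => lt_card.
set q := (k * (m * D))%N in lt_card; pose B := (d * q).+1.
have [s us szs] := infinite_uniq_seq infK B.
pose E : finType := {ffun 'I_m -> 'I_D.+1}.
pose mon : E -> {mpoly K[#|Idn n d|]} := chain_mon f0 f m.
have hmon e : mon e \is q.-homog by apply: chain_mon_homog.
(* Grid points whose coordinates outside [S p] are frozen at index 0, so that a piece contributes at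
   most B^N of them. *)
pose inQ p (g : {ffun J -> 'I_B}) := g \in pffun_on ord0 (mem (S p)) predT.
pose Q := [set pg : P * {ffun J -> 'I_B} | inQ pg.1 pg.2].
have cardQ : (#|Q| <= #|P| * B ^ N)%N.
  rewrite cardsE -sum1_card -(pair_big_dep xpredT inQ (fun _ _ => 1%N)) /=.
  rewrite -sum_nat_const; apply: leq_sum => p _.
  rewrite sum1_card (eq_card (B := pffun_on ord0 (mem (S p)) predT)) //.
  rewrite card_pffun_on card_ord leq_pexp2l //; exact: cardS.
pose pt (g : {ffun J -> 'I_B}) : {ffun J -> K} := [ffun j => nth 0 s (g j)].
pose val_at (e : E) p y := (mon e).@[minors (Psi p y)].
(* Rows are monomials and columns are grid points. There are more rows than columns, so a nonzero
   row vector kills A: a combination of monomials vanishing on all grids. *)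
pose A : 'M[K]_(#|E|, #|Q|) := \matrix_(a, b)
  val_at (enum_val a) (enum_val b).1 (pt (enum_val b).2).
have /rowV0Pn[v /sub_kermxP vA v0] : kermx A != 0.
  rewrite kermx_eq0 -row_leq_rank -ltnNge.
  apply: leq_ltn_trans (rank_leq_col A) _; apply: leq_ltn_trans cardQ _.
  by rewrite card_ffun !card_ord.
pose c (e : E) := v 0 (enum_rank e).
have c_grid p g : inQ p g -> \sum_e c e * val_at e p (pt g) = 0.
  move=> pgQ; have inQ_pg : (p, g) \in Q by rewrite inE.
  have /rowP/(_ (enum_rank_in inQ_pg (p, g))) := vA; rewrite !mxE => vAb.
  rewrite -[RHS]vAb [RHS](reindex enum_rank) /=;
    last exact: (onW_bij _ (@enum_rank_bij _)).
  by apply: eq_bigr => e _; rewrite mxE enum_rankK enum_rankK_in.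
have c_piece p y : \sum_e c e * val_at e p y = 0.
  apply: (sep_polyfun_grid us (c := (d * q)%N) (F := fun y =>
    \sum_e c e * val_at e p y)).
  - by rewrite szs.
  - move=> {}y j; apply: polyfun_sum => e; apply: (@polyfunM _ 0 (d * q)).
      exact: polyfun_const.
    apply: polyfun_meval (hmon e) _ => l; apply: polyfun_det => u t.
    by apply: eq_polyfun (polyPsi p (idx l u) t y j) => a; rewrite mxE.
  move=> {}y ys; pose g : {ffun J -> 'I_B} :=
    [ffun j => if j \in S p then inord (index (y j) s) else ord0].
  have PsiE : Psi p (pt g) = Psi p y.
    apply: eqPsi => j jS; rewrite !ffunE jS inordK ?nth_index //.
    by have := ys j; rewrite -index_mem szs.
  rewrite /val_at -PsiE; apply: c_grid; apply/pffun_onP; split=> //.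
  by apply/supportP => j jS; rewrite ffunE (negbTE jS).
have c0 : forall e, c e = 0.
  apply: (chain_mon_free chainZ hf0 hf f0x fZ fZ1) => U ZU.
  have [irrZ _] := chainZ; have [_ _ ZX _] := irrZ m (leqnn m).
  have [p [y [fPsi ->]]] := XPsi U (ZX U ZU).
  pose G := \sum_e c e *: mon e.
  have hG : G \is q.-homog by apply: rpred_sum => e _; apply: rpredZ.
  have GE w : G.@[w] = \sum_e c e * (mon e).@[w].
    by rewrite /G raddf_sum; apply: eq_bigr => e _ /=; rewrite mevalZ.
  by apply/eqP; rewrite -GE (meval_plucker_cspan hG) // GE c_piece.
case/eqP: v0; apply/rowP => a; rewrite mxE -(enum_valK a); exact: c0.
Qed.

End ChainLength.

(** * The local dimension *)

Section IndexPosets.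

Variables (n d : nat).

Implicit Types (k lo hi : 'I_#|Idn n d|) (h : 'I_d -> 'I_n).

Lemma mono_idx h :
  (forall s t : 'I_d, (s < t)%N -> (h s < h t)%N) -> exists k, idx k =1 h.
Proof.
move=> mh; have injh : injective h.
  by move=> s t E; apply/val_inj/eqP; case: ltngtP => // /mh; rewrite E ltnn.
have [k [p hE]] := sort_idx injh; exists k => t; apply/val_inj/eqP.
rewrite eqn_leq (leq_matching (f := idx k) (g := h) (p := p)) //=.
- rewrite (leq_matching (f := h) (g := idx k) (p := p^-1%g)) //.
    exact: idx_mono.
  by move=> s; rewrite hE permKV.
- exact: idx_mono.
by move=> s; rewrite hE.
Qed.

Lemma le_idx_refl k : le_idx k k.
Proof. exact/le_idxP. Qed.

Lemma le_idx_trans k lo hi : le_idx lo k -> le_idx k hi -> le_idx lo hi.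
Proof.
by move=> /le_idxP lk /le_idxP kh; apply/le_idxP => t;
  apply: leq_trans (lk t) (kh t).
Qed.

Definition idx_sum k : nat := \sum_t idx k t.

Lemma idx_sum_le k l : le_idx k l -> (idx_sum k <= idx_sum l)%N.
Proof. by move=> /le_idxP kl; apply: leq_sum. Qed.

(** The first entry at which hi exceeds k is lowered by one. Earlier entries of hi agree with those
    of k, so the tuple stays strictly increasing and above k. *)
Lemma idx_lower k hi : le_idx k hi -> k != hi ->
  exists hi', [/\ le_idx k hi', le_idx hi' hi & idx_sum hi = (idx_sum hi').+1].
Proof.
move=> /le_idxP le_k nkhi.
have [s0 lt0] : exists s, (idx k s < idx hi s)%N.
  apply/existsP; apply: contraNT nkhi => /existsPn eq_k; apply/eqP/eq_idx => s.
  by apply/val_inj/eqP; rewrite eqn_leq le_k leqNgt eq_k.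
case: (@arg_minnP _ s0 (fun s => (idx k s < idx hi s)%N) (fun s => s) lt0).
move=> s lt_s min_s.
pose h u := if u == s then Ordinal (leq_ltn_trans (leq_pred _) (ltn_ord (idx hi
  s)))
            else idx hi u.
have hE u : h u = (if u == s then (idx hi s).-1 else idx hi u) :> nat.
  by rewrite /h; case: ifP.
have [hi' hi'E] : exists hi', idx hi' =1 h.
  apply: mono_idx => u t lt_ut; rewrite !hE.
  have lt_hi := idx_mono hi lt_ut.
  case: eqP => [us|/eqP us]; case: eqP => [ts|/eqP ts] //; subst.
  - by rewrite ltnn in lt_ut.
  - exact: leq_ltn_trans (leq_pred _) lt_hi.
  have : (idx hi u <= idx k u)%N.
    by rewrite leqNgt; apply/negP => /min_s /=; rewrite leqNgt lt_ut.
  by have := idx_mono k lt_ut; lia.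
exists hi'; split.
- apply/le_idxP => u; rewrite hi'E hE; case: eqP => [->|_]; last exact: le_k.
  by lia.
- by apply/le_idxP => u; rewrite hi'E hE; case: eqP => [->|_];
  rewrite ?leq_pred.
rewrite /idx_sum (bigD1 s) //= [X in _ = X.+1](bigD1 s) //= hi'E hE eqxx.
rewrite -addSn prednK; last by lia.
by congr addn; apply: eq_bigr => u us; rewrite hi'E hE (negbTE us).
Qed.

(** Dual to [idx_lower]: the last entry at which lo is below k is raised. *)
Lemma idx_raise lo k : le_idx lo k -> k != lo ->
  exists lo', [/\ le_idx lo' k, le_idx lo lo' & idx_sum lo' = (idx_sum lo).+1].
Proof.
move=> /le_idxP le_k nklo.
have [s0 lt0] : exists s, (idx lo s < idx k s)%N.
  apply/existsP; apply: contraNT nklo => /existsPn eq_k; apply/eqP/eq_idx => s.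
  by apply/val_inj/eqP; rewrite eqn_leq le_k leqNgt eq_k.
case: (@arg_maxnP _ s0 (fun s => (idx lo s < idx k s)%N) (fun s => s) lt0).
move=> s lt_s max_s.
pose h u := if u == s then Ordinal (leq_ltn_trans lt_s (ltn_ord (idx k s)))
            else idx lo u.
have hE u : h u = (if u == s then (idx lo s).+1 else idx lo u) :> nat.
  by rewrite /h; case: ifP.
have [lo' lo'E] : exists lo', idx lo' =1 h.
  apply: mono_idx => u t lt_ut; rewrite !hE.
  have lt_lo := idx_mono lo lt_ut.
  case: eqP => [us|/eqP us]; case: eqP => [ts|/eqP ts] //; subst.
  - by rewrite ltnn in lt_ut.
  - have : (idx k t <= idx lo t)%N.
      by rewrite leqNgt; apply/negP => /max_s /=; rewrite /geq /= leqNgt lt_ut.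
    by have := idx_mono k lt_ut; lia.
  exact: leq_trans lt_lo _.
exists lo'; split.
- by apply/le_idxP => u; rewrite lo'E hE; case: eqP => [->|_].
- by apply/le_idxP => u; rewrite lo'E hE; case: eqP => [->|_].
rewrite /idx_sum (bigD1 s) //= [X in _ = X.+1](bigD1 s) //= lo'E hE eqxx.
rewrite -addSn.
by congr addn; apply: eq_bigr => u us; rewrite lo'E hE (negbTE us).
Qed.

Lemma card_ord_interval (a b : nat) :
  (#|[set i : 'I_n | a <= i < b]| <= b - a)%N.
Proof.
rewrite cardE -(size_map val) -(size_iota a (b - a)).
apply: uniq_leq_size => [|_ /mapP[i + ->]].
  by rewrite map_inj_uniq ?enum_uniq //; apply: val_inj.
by rewrite mem_enum inE mem_iota /=; lia.
Qed.

End IndexPosets.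

(** * The variety of an interval of indices and its local dimension *)

Section IntervalVariety.

Local Open Scope ring_scope.

Variables (K : fieldType) (n d : nat).
Hypothesis infK : infinite_field K.

Implicit Types (M : 'M[K]_(n, d)) (k lo hi : 'I_#|Idn n d|).

(** The Richardson variety by its equations, with lo in the role of v and hi in that of w. *)
Definition interval_variety lo hi (U : {vspace 'cV[K]_n}) : Prop :=
  grass d U /\ forall k, plucker U k != 0 -> le_idx lo k /\ le_idx k hi.

Lemma zclosed_interval_variety lo hi : zclosed d (interval_variety lo hi).
Proof.
exists (fun f => exists2 k, ~ (le_idx lo k /\ le_idx k hi) & f = 'X_k).
  by move=> _ [k _ ->]; exists 1%N; apply: dhomog_XU.
move=> U; split=> -[gU supU]; split=> //.
  by move=> _ [k nk ->]; rewrite mevalXU; apply/eqP/negPn/negP => /supU.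
move=> k Uk; apply: NNPP => nk; case/eqP: Uk.
by have := supU 'X_k; rewrite mevalXU; apply; exists k.
Qed.

(** A nonzero Leibniz term matches the rows of the minor with the columns, hence with entries of
    both lo and hi. *)
Lemma banded_support M lo hi k :
    banded M (idx lo) (idx hi) -> minors M k != 0 ->
  le_idx lo k /\ le_idx k hi.
Proof.
move=> bM /det_neq0_perm[p nz].
have b s : (idx lo (p s) <= idx k s <= idx hi (p s))%N.
  by apply: bM; have := nz s; rewrite mxE.
split; first by apply: (@le_idx_matching _ _ _ _ p) => s; have /andP[] := b s.
apply: (@le_idx_matching _ _ _ _ p^-1%g) => s.
by have /andP[_] := b (p^-1%g s); rewrite permKV.
Qed.

(** The members of the chains: banded matrices form a linear space, so these closures are
    irreducible by the argument along lines. *)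
Definition band_closure lo hi : {vspace 'cV[K]_n} -> Prop :=
  zclosure d (family (fun M => banded M (idx lo) (idx hi))).

Lemma coord_mx_banded lo k hi : le_idx lo k -> le_idx k hi ->
  banded (coord_mx K (idx k)) (idx lo) (idx hi).
Proof.
move=> /le_idxP lk /le_idxP kh i t; rewrite mxE.
by case: (i =P idx k t) => [->|]; rewrite ?eqxx // lk kh.
Qed.

Lemma coord_family lo k hi : le_idx lo k -> le_idx k hi ->
  family (fun M => banded M (idx lo) (idx hi)) (cspan (coord_mx K (idx k))).
Proof.
move=> lk kh; exists (coord_mx K (idx k)); split=> //.
  exact: coord_mx_banded.
exact/coord_mx_full/idx_inj.
Qed.

Lemma band_closure_point lo k hi : le_idx lo k -> le_idx k hi ->
  band_closure lo hi (cspan (coord_mx K (idx k))).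
Proof. by move=> lk kh; apply: sub_zclosure; apply: coord_family. Qed.

Lemma band_closure_irreducible lo hi :
  le_idx lo hi -> zirreducible d (band_closure lo hi).
Proof.
move=> le_lh; have lo_lo := le_idx_refl lo.
apply: family_irreducible => //.
  by exists (cspan (coord_mx K (idx lo))); apply: coord_family.
move=> M1 M2 s b1 b2 i t nz; have [M1it|] := eqVneq (M1 i t) 0; last exact: b1.
have [M2it|] := eqVneq (M2 i t) 0; last exact: b2.
by move: nz; rewrite !mxE M1it M2it subrr mulr0 addr0 eqxx.
Qed.

Lemma zclosed_band_closure lo hi : zclosed d (band_closure lo hi).
Proof. apply: zclosed_zclosure; exact: family_grass. Qed.

Lemma band_closureS lo hi lo' hi' : le_idx lo lo' -> le_idx hi' hi ->
  subpt (band_closure lo' hi') (band_closure lo hi).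
Proof.
move=> /le_idxP ll /le_idxP hh; apply: zclosureS => _ [M [bM fM ->]].
exists M; split=> // i t /bM /andP[li ih].
by rewrite (leq_trans (ll t) li) (leq_trans ih (hh t)).
Qed.

Lemma band_closure_sub lo hi :
  subpt (band_closure lo hi) (interval_variety lo hi).
Proof.
apply: zclosure_min => [|_ [M [bM fM ->]]];
  first exact: zclosed_interval_variety.
split=> [|k]; first exact: dim_cspan.
by rewrite plucker_cspan_eq0 // => /(banded_support bM).
Qed.

Lemma coord_interval_variety k lo hi :
    interval_variety lo hi (cspan (coord_mx K (idx k))) ->
  le_idx lo k /\ le_idx k hi.
Proof.
case=> _; apply; rewrite plucker_cspan_eq0 ?minors_coord_mx ?eqxx ?oner_eq0 //.
exact/coord_mx_full/idx_inj.
Qed.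

(** Each step lowers hi if it differs from k and raises lo otherwise. It is strict because the
    coordinate point of the old end lies in the larger closure, while its sum of entries rules it
    out of the smaller interval. *)
Lemma band_chain k m lo hi :
    le_idx lo k -> le_idx k hi -> idx_sum hi = (m + idx_sum lo)%N ->
  exists Z, chain_at d (band_closure lo hi) (cspan (coord_mx K (idx k))) m Z.
Proof.
elim: m => [|m IHm] in lo hi *; move=> lk kh sumE.
  have le_lh := le_idx_trans lk kh.
  exists (fun=> band_closure lo hi); split=> // i _; split=> //.
  - exact: zclosed_band_closure.
  - exact: band_closure_irreducible.
  exact: band_closure_point.
suff [lo' [hi' [lk' kh' [ll hh] sumE' strict]]] : exists lo' hi',
    [/\ le_idx lo' k, le_idx k hi', le_idx lo lo' /\ le_idx hi' hi,
        idx_sum hi' = (m + idx_sum lo')%N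
      & ~ subpt (band_closure lo hi) (band_closure lo' hi')].
  have [Z [irrZ strictZ]] := IHm _ _ lk' kh' sumE'.
  have subY := band_closureS ll hh.
  exists (fun i => if (i <= m)%N then Z i else band_closure lo hi); split=> i.
    case: ifP => [im _|_ _].
      have [cZ iZ ZX Zx] := irrZ i im; split=> // U /ZX; exact: subY.
    split=> //; first exact: zclosed_band_closure.
      exact: band_closure_irreducible (le_idx_trans lk kh).
    exact: band_closure_point.
  rewrite ltnS => im; rewrite im; case: ifP => [|/negbT]; first exact: strictZ.
  rewrite -leqNgt => mi; have [_ _ ZX _] := irrZ i im.
  split=> [U /ZX /subY //|subZ]; apply: strict => U /subZ /ZX.
  by [].
have le_lh := le_idx_trans lk kh; have refl := @le_idx_refl n d.
have strict l lo' hi' : le_idx lo l -> le_idx l hi ->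
    ~ (le_idx lo' l /\ le_idx l hi') ->
    ~ subpt (band_closure lo hi) (band_closure lo' hi').
  move=> lol lhi nl sub; apply: nl; apply: coord_interval_variety.
  by apply: band_closure_sub; apply: sub; apply: band_closure_point.
have [khi|nkhi] := eqVneq k hi.
  have [klo|nklo] := eqVneq k lo; first by move: sumE; rewrite -khi -klo; lia.
  have [lo' [lk' ll sumlo]] := idx_raise lk nklo.
  exists lo', hi; split=> //; first by lia.
  apply: (strict lo) => // -[/idx_sum_le]; lia.
have [hi' [kh' hh sumhi]] := idx_lower kh nkhi.
exists lo, hi'; split=> //; first by lia.
apply: (strict hi) => // -[_ /idx_sum_le]; lia.
Qed.

(** Bottom entries are normalised to 1, leaving b t - a t free entries in column t. All pieces share
    one parameter space, of which each reads only the coordinates in its bands. *)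
Definition band_mx (a b : 'I_d -> 'I_n) (y : {ffun 'I_n * 'I_d -> K}) :
    'M[K]_(n, d) :=
  \matrix_(i, t) if i == b t then 1 else if (a t <= i < b t)%N then y (i,
    t) else 0.

Lemma leading_bottom M a b : echelon M a b -> leading (@nat_of_ord n) M b.
Proof. by case=> _ _ _ Mb bM; split=> // i t /bM /andP[]. Qed.

Lemma leading_top M a b :
  echelon M a b -> leading (fun i : 'I_n => (n - i)%N) M a.
Proof. by case=> _ _ Ma _ bM; split=> // i t /bM /andP[ai _];
  apply: leq_sub2l. Qed.

Lemma rev_rank_inj : injective (fun i : 'I_n => (n - i)%N).
Proof. by move=> i j E; apply: val_inj => /=; have := ltn_ord i;
  have := ltn_ord j; lia. Qed.

(** In an echelon basis the minors on the bottom rows and on the top rows are triangular, hence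
    nonzero. Both row sets therefore index points of the interval, which bounds the sum of b above
    and the sum of a below. *)
Lemma interval_variety_param lo hi U : interval_variety lo hi U ->
  exists (a b : 'I_d -> 'I_n) y, [/\ (\sum_t (b t - a t) <= idx_sum hi -
    idx_sum lo)%N,
    row_full (band_mx a b y) & U = cspan (band_mx a b y)].
Proof.
move=> [gU supU]; have fB := row_full_basis_mx gU.
have [C uC [a [b ech]]] := two_sided_echelon fB.
set M := _ *m C in ech; have fM : row_full M by apply: row_full_mulr.
have UE : cspan M = U by rewrite cspan_mulr // cspan_basis_mx.
clearbody M; have [ia ib Ma Mb bM] := ech.
have le_ab t : (a t <= b t)%N by have /andP[] := bM _ _ (Ma t).
have sum_b : (\sum_t b t <= idx_sum hi)%N.
  have := det_leading (@ord_inj n) ib (leading_bottom ech).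
  case/det_rowsub_neq0 => k [p [bE]]; rewrite -plucker_cspan_eq0 // UE.
  case/supU => _ /idx_sum_le; apply: leq_trans.
  by rewrite /idx_sum [X in (_ <= X)%N](reindex_inj (@perm_inj _ p)) leq_sum //
    => t;
    rewrite bE.
have sum_a : (idx_sum lo <= \sum_t a t)%N.
  have := det_leading rev_rank_inj ia (leading_top ech).
  case/det_rowsub_neq0 => k [p [aE]]; rewrite -plucker_cspan_eq0 // UE.
  case/supU => /idx_sum_le /leq_trans + _; apply.
  by rewrite /idx_sum [X in (X <= _)%N](reindex_inj (@perm_inj _ p)) leq_sum //
    => t;
    rewrite aE.
pose D : 'M[K]_d := diag_mx (\row_t (M (b t) t)^-1).
have uD : D \in unitmx.
  rewrite unitmxE det_diag unitfE; apply/prodf_neq0 => t _.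
  by rewrite mxE invr_eq0.
exists a, b, [ffun it => (M *m D) it.1 it.2].
have -> : band_mx a b [ffun it => (M *m D) it.1 it.2] = M *m D.
  apply/matrixP => i t; rewrite mxE ffunE /= mul_mx_diag !mxE.
  case: eqP => [->|/eqP ib_t]; first by rewrite divff.
  case: ifP => // out; have [->|/bM /andP[ai ibt]] := eqVneq (M i t) 0.
    by rewrite mul0r.
  by move: out; rewrite ai ltn_neqAle ibt andbT (inj_eq val_inj) ib_t.
split; last by rewrite cspan_mulr.
  rewrite sumnB // leq_sub //.
exact: row_full_mulr.
Qed.

Lemma interval_variety_local_dim lo k hi : le_idx lo k -> le_idx k hi ->
  local_dim d (interval_variety lo hi) (cspan (coord_mx K (idx k)))
    (idx_sum hi - idx_sum lo).
Proof.
move=> lk kh; have le_sum : (idx_sum lo <= idx_sum hi)%N.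
  exact: leq_trans (idx_sum_le lk) (idx_sum_le kh).
split=> [|m Z chainZ].
  have [Z [irrZ strictZ]] := band_chain lk kh (esym (subnK le_sum)).
  exists Z; split=> // i im; have [cZ iZ ZX Zx] := irrZ i im; split=> //.
  by move=> U /ZX; apply: band_closure_sub.
set N := (_ - _)%N.
(* The pieces: one for each pair of bottoms and tops of admissible total width, hence finitely
   many. *)
pose P : finType := {ab : {ffun 'I_d -> 'I_n} * {ffun 'I_d -> 'I_n} |
  (\sum_t (ab.2 t - ab.1 t) <= N)%N}.
pose S (p : P) := [set it : 'I_n * 'I_d |
  ((val p).1 it.2 <= it.1 < (val p).2 it.2)%N].
pose Psi (p : P) y := band_mx (val p).1 (val p).2 y.
apply: (chain_length_le infK (Psi := Psi) (S := S)) chainZ =>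
  [p i t y j|p y y' yS|p|U].
- have [E|NE] := eqVneq (i, t) j; last first.
    apply: eq_polyfun (polyfun_const _ (Psi p y i t)) => s.
    by rewrite !mxE ffunE (negbTE NE).
  rewrite -E; apply: (@eq_polyfun _ _ (fun s => if i == (val p).2 t then 1
    else if ((val p).1 t <= i < (val p).2 t)%N then 0 + s * 1 else 0)).
    by move=> s; rewrite !mxE ffunE eqxx add0r mulr1.
  case: (i == _); first exact: polyfun_const.
  case: (_ && _); [exact: polyfun_affine | exact: polyfun_const].
- apply/matrixP => i t; rewrite !mxE; case: ifP => // _; case: ifP => // it.
  by apply: yS; rewrite inE.
- apply: leq_trans (valP p); rewrite -sum1_card.
  rewrite (eq_bigl (fun it => predT it.2 && (it.1 \in
    [set i : 'I_n | ((val p).1 it.2 <= i < (val p).2 it.2)%N]))); last first.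
    by move=> it; rewrite !inE.
  rewrite (reindex (fun ti : 'I_d * 'I_n => (ti.2, ti.1))) /=; last first.
    by exists (fun it => (it.2, it.1)) => -[].
  rewrite -(pair_big_dep xpredT (fun t i => i \in
    [set i : 'I_n | ((val p).1 t <= i < (val p).2 t)%N]) (fun _ _ => 1%N)) /=.
  apply: leq_sum => t _; rewrite sum1_card; exact: card_ord_interval.
move=> /interval_variety_param[a [b [y [le_N fM ->]]]].
have le_N' : (\sum_t ([ffun t => b t] t - [ffun t => a t] t) <= N)%N.
  by under eq_bigr do rewrite !ffunE.
exists (exist _ ([ffun t => a t], [ffun t => b t]) le_N'), y.
have -> : Psi (exist _ ([ffun t => a t], [ffun t =>
  b t]) le_N') y = band_mx a b y.
  by apply/matrixP => i t; rewrite !mxE /= !ffunE.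
by [].
Qed.

End IntervalVariety.

(** * The tangent space *)

Section CoordinateSubspace.

Local Open Scope ring_scope.

Variables (K : fieldType) (N : nat) (A : {set 'I_N}).

Lemma coordinate_subspace : exists2 T : {vspace 'rV[K]_N},
  forall y, y \in T <-> (forall k, k \notin A -> y 0 k = 0) & \dim T = #|A|.
Proof.
pose P : 'M[K]_(#|A|, N) := \matrix_(a, k) (enum_val a == k)%:R.
have PE (z : 'rV_#|A|) a : (z *m P) 0 (enum_val a) = z 0 a.
  rewrite mxE (bigD1 a) //= mxE eqxx mulr1 big1 ?addr0 // => b ba.
  by rewrite mxE (inj_eq enum_val_inj) (negbTE ba) mulr0.
exists (limg (linfun (mulmxr P : 'rV_#|A| -> 'rV_N))) => [y|]; last first.
  rewrite limg_dim_eq ?dimvf; first exact: mul1n.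
  apply/eqP; rewrite -subv0; apply/subvP => z;
    rewrite memv_cap memvf memv_ker /=.
  rewrite lfunE /= => /eqP zP; rewrite memv0; apply/eqP/rowP => a.
  by rewrite -PE zP !mxE.
split=> [/memv_imgP[z _ ->] k kA|y0].
  rewrite lfunE /= mxE big1 // => a _; rewrite mxE.
  by case: (enum_val a =P k) => [ak|_]; [rewrite -ak enum_valP in kA |
    rewrite mulr0].
apply/memv_imgP; exists (\row_a y 0 (enum_val a)); rewrite ?memvf // lfunE /=.
apply/rowP => k; have [kA|kA] := boolP (k \in A).
  by rewrite -(enum_rankK_in kA kA) PE mxE.
rewrite y0 // mxE big1 // => a _; rewrite !mxE.
by case: (enum_val a =P k) => [ak|_]; [rewrite -ak enum_valP in kA |
  rewrite mulr0].
Qed.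

End CoordinateSubspace.

Section TangentSpace.

Local Open Scope ring_scope.

Variables (K : fieldType) (n d : nat).
Hypothesis infK : infinite_field K.
Hypothesis d_gt0 : (0 < d)%N.

Implicit Types (M : 'M[K]_(n, d)) (k l lo hi : 'I_#|Idn n d|).

Definition replace (h : 'I_d -> 'I_n) t j : 'I_d -> 'I_n :=
  fun u => if u == t then j else h u.

Lemma det_replace_row m (A B : 'M[K]_m) i :
    (forall s t, s != i -> A s t = B s t) ->
  \det B = \sum_t B i t * cofactor A i t.
Proof.
move=> AB; rewrite (expand_det_row B i); apply: eq_bigr => t _.
congr (_ * (_ * \det _)); apply/matrixP => s u; rewrite !mxE.
by rewrite AB // eq_sym neq_lift.
Qed.

(** Cramer's rule writes [\det Q] times row s of R as a combination of the rows of Q; this is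
    inserted into the expansion of [\det R] along row s. *)
Lemma det_exchange m (Q R : 'M[K]_m) s :
  \det Q * \det R = \sum_t (\sum_v R s v * cofactor Q t v) *
                            (\sum_u Q t u * cofactor R s u).
Proof.
have Qadj u : \sum_t (\sum_v R s v * cofactor Q t v) * Q t u = \det Q * R s u.
  have /rowP/(_ u) := congr1 (mulmx (row s R)) (mul_adj_mx Q).
  rewrite mul_mx_scalar mulmxA !mxE => <-; apply: eq_bigr => t _.
  by rewrite mxE; congr (_ * _); apply: eq_bigr => v _; rewrite !mxE.
rewrite (expand_det_row R s) mulr_sumr.
under eq_bigr do rewrite mulrA -Qadj mulr_suml.
rewrite exchange_big; apply: eq_bigr => t _ /=.
by rewrite mulr_sumr; apply: eq_bigr => u _; rewrite mulrA.
Qed.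

(** Quadratic Pluecker relation in which one entry of l is exchanged with each entry of k in
    turn. *)
Lemma exchange_relation M k l s :
  minors M k * minors M l =
  \sum_t \det (rowsub (replace (idx k) t (idx l s)) M) *
         \det (rowsub (replace (idx l) s (idx k t)) M).
Proof.
set Q := rowsub (idx k) M; set R := rowsub (idx l) M.
have cE t : \det (rowsub (replace (idx k) t (idx l s)) M) =
            \sum_u R s u * cofactor Q t u.
  rewrite (@det_replace_row _ Q _ t) => [|i u it].
    by apply: eq_bigr => u _; rewrite !mxE /replace eqxx.
  by rewrite !mxE /replace (negbTE it).
have rE t : \det (rowsub (replace (idx l) s (idx k t)) M) =
            \sum_u Q t u * cofactor R s u.
  rewrite (@det_replace_row _ R _ s) => [|i u is_].
    by apply: eq_bigr => u _; rewrite !mxE /replace eqxx.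
  by rewrite !mxE /replace (negbTE is_).
rewrite /minors -/Q -/R (det_exchange Q R s); apply: eq_bigr => t _.
by rewrite cE rE.
Qed.

(** A linear form in the Pluecker coordinates standing for the minor on rows h, which may be
    unsorted or repeated as happens after an exchange. *)
Definition minor_form (h : 'I_d -> 'I_n) : {mpoly K[#|Idn n d|]} :=
  \sum_k \det (rowsub h (coord_mx K (idx k))) *: 'X_k.

Lemma minor_form_homog h : minor_form h \is 1.-homog.
Proof. by apply: rpred_sum => k _; apply: rpredZ; apply: dhomog_XU. Qed.

Lemma minor_formE h v :
  (minor_form h).@[v] = \sum_k \det (rowsub h (coord_mx K (idx k))) * v k.
Proof.
by rewrite (raddf_sum (meval v)); apply: eq_bigr => k _ /=;
  rewrite mevalZ mevalXU.
Qed.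

Lemma minor_form_minors h M : (minor_form h).@[minors M] = \det (rowsub h M).
Proof. by rewrite minor_formE [RHS]det_rowsub_expand. Qed.

(* The indices agree outside one position, so that [exchange k k] holds. *)
Definition exchange k l : bool :=
  [exists p : 'S_d, exists s, forall t, (t != s) ==> (idx l (p t) == idx k t)].

Lemma exchangeP k l : reflect (exists (p : 'S_d) s,
  forall t, t != s -> idx l (p t) = idx k t) (exchange k l).
Proof.
apply: (iffP existsP) => [[p /existsP[s /forallP pE]]|[p [s pE]]].
  by exists p, s => t ts; have /implyP/(_ ts)/eqP := pE t.
exists p; apply/existsP; exists s; apply/forallP => t; apply/implyP => ts.
by rewrite pE.
Qed.

Definition form_deriv (v : 'I_#|Idn n d| -> K) (y : 'rV[K]_#|Idn n d|)
    (f : {mpoly K[#|Idn n d|]}) : K :=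
  \sum_i (f^`M(i)).@[v] * y 0 i.

Lemma form_derivM v y f g :
  form_deriv v y (f * g) = form_deriv v y f * g.@[v] + f.@[v] * form_deriv v y
    g.
Proof.
rewrite /form_deriv mulr_suml mulr_sumr -big_split; apply: eq_bigr => i _ /=.
by rewrite mderivM mevalD !mevalM mulrDl mulrAC mulrA.
Qed.

Lemma form_derivB v y f g :
  form_deriv v y (f - g) = form_deriv v y f - form_deriv v y g.
Proof.
rewrite /form_deriv -sumrB; apply: eq_bigr => i _.
by rewrite mderivB mevalB mulrBl.
Qed.

Lemma form_deriv_sum v y (I : finType) (F : I -> {mpoly K[#|Idn n d|]}) :
  form_deriv v y (\sum_t F t) = \sum_t form_deriv v y (F t).
Proof.
rewrite /form_deriv exchange_big; apply: eq_bigr => i _ /=.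
by rewrite (raddf_sum (mderiv i)) (raddf_sum (meval v)) mulr_suml.
Qed.

Lemma form_derivX v y k : form_deriv v y 'X_k = y 0 k.
Proof.
rewrite /form_deriv (bigD1 k) //= mderivXU eqxx meval1 mul1r big1 ?addr0 //.
by move=> i ik; rewrite mderivXU (negbTE ik) meval0 mul0r.
Qed.

Variables (lo k0 hi : 'I_#|Idn n d|).
Hypotheses (lo_k0 : le_idx lo k0) (k0_hi : le_idx k0 hi).

Let x := cspan (coord_mx K (idx k0)).

Let x_full : row_full (coord_mx K (idx k0)).
Proof. by apply: coord_mx_full; apply: idx_inj. Qed.

(** The index [k0] belongs to this set, since the cone over the tangent space contains the line of
    x. *)
Definition tangent_indices : {set 'I_#|Idn n d|} :=
  [set k | exchange k0 k && (le_idx lo k && le_idx k hi)].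

Lemma exchange_refl : exchange k0 k0.
Proof. by apply/exchangeP; exists 1%g, (Ordinal d_gt0) => t _;
  rewrite perm1. Qed.

(* For an index not exchanged with [k0], the differential at [x] of the relation
   [exchange_relation] is a multiple of the coordinate of that index. *)
Lemma tangent_support y k : tangent (interval_variety lo hi) x y ->
  k \notin tangent_indices -> y 0 k = 0.
Proof.
move=> ty; rewrite inE negb_and => kA.
have [kint|kint] := boolP (le_idx lo k && le_idx k hi); last first.
  have := ty 1%N 'X_k (dhomog_XU _ _); rewrite -/(form_deriv _ _ _) form_derivX.
  apply=> U [_ supU]; rewrite mevalXU; apply/eqP/negPn/negP => /supU[lk kh].
  by rewrite lk kh in kint.
rewrite kint orbF in kA.
have nk0 : k != k0 by apply: contraNneq kA => ->; apply: exchange_refl.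
have [s sk0] : exists s, idx k s \notin codom (idx k0).
  apply/existsP; apply: contraNT nk0 => /existsPn all_k0.
  have /fin_all_exists[q qE] u : exists t, idx k u = idx k0 t.
    by have /negPn/codomP := all_k0 u.
  have injq : injective q by move=> u t E; apply: (@idx_inj _ _ k);
    rewrite !qE E.
  by apply/eqP/esym/(@eq_idx_perm _ _ _ _ (perm injq)) => t; rewrite permE qE.
have [c c0 xE] := plucker_cspan x_full.
pose F t : {mpoly K[#|Idn n d|]} := minor_form (replace (idx k0) t (idx k s)) *
            minor_form (replace (idx k) s (idx k0 t)).
pose f : {mpoly K[#|Idn n d|]} := 'X_k0 * 'X_k - \sum_t F t.
have hf : f \is (1 + 1).-homog.
  apply: rpredB; first by apply: dhomogM; apply: dhomog_XU.
  by apply: rpred_sum => t _; apply: dhomogM; apply: minor_form_homog.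
have f0 U : interval_variety lo hi U -> f.@[plucker U] = 0.
  move=> _; rewrite mevalB mevalM !mevalXU -[plucker U]/(minors (basis_mx d U)).
  rewrite (exchange_relation _ _ _ s) (raddf_sum (meval _)) -sumrB big1 // =>
    t _.
  by rewrite /F /= mevalM !minor_form_minors subrr.
(* At x only the coordinate [k0] is nonzero. Both factors of each [F t] vanish there: the first
   involves an entry of k foreign to [k0], and a nonzero second one would make k exchanged with
   [k0]. So the differential of [F t] at x is zero. *)
have form0 h : (forall p : 'S_d, ~ forall t, h t = idx k0 (p t)) ->
    (minor_form h).@[plucker x] = 0.
  move=> nh; rewrite minor_formE (bigD1 k0) //= big1 ?addr0 => [|l lk0].
    have [->|/det_rowsub_coord_mx[p hE]] := eqVneq (\det (rowsub h (coord_mx K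
      (idx k0)))) 0.
      by rewrite mul0r.
    by case: (nh p).
  by rewrite xE minors_coord_mx (negbTE lk0) !mulr0.
have := ty _ _ hf f0; rewrite -/(form_deriv _ _ _) form_derivB form_derivM.
rewrite !form_derivX !mevalXU form_deriv_sum big1 => [|t _].
  rewrite subr0 !xE !minors_coord_mx eqxx (negbTE nk0) mulr0 mulr1 mulr0 add0r.
  by move/eqP; rewrite mulf_eq0 (negbTE c0) => /eqP.
rewrite form_derivM !form0 ?mulr0 ?mul0r ?addr0 // => p pE.
  by case/negP: sk0; apply/codomP; exists (p t); rewrite -pE /replace eqxx.
case/negP: kA; apply/exchangeP; exists p^-1%g, (p s) => u us.
rewrite -{2}(permKV p u) -pE /replace; case: eqP => // E.
by rewrite -E permKV eqxx in us.
Qed.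

(* The line joining [x] to the coordinate point of [k] lies on the variety. *)
Lemma tangent_deriv k e (f : {mpoly K[#|Idn n d|]}) : k \in tangent_indices ->
    f \is e.-homog ->
    (forall U, interval_variety lo hi U -> f.@[plucker U] = 0) ->
  (f^`M(k)).@[plucker x] = 0.
Proof.
rewrite inE => /andP[/exchangeP[p [s pE]] /andP[lk kh]] hf f0.
have [C uC basisE] := basis_mx_cspan x_full.
have detC0 : \det C != 0 by rewrite -unitfE -unitmxE.
pose sg : K := (-1) ^+ p; have sg0 : sg != 0 by rewrite signr_eq0.
(* Column s of the coordinate matrix of [k0] receives u in row [idx k (p s)]; multilinearity in that
   column yields one extra minor, at k, with the sign of p. *)
pose M u : 'M[K]_(n, d) :=
  \matrix_(i, t) ((i == idx k0 t)%:R + u * ((t == s) && (i == idx k (p s)))%:R).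
have ME u l : minors (M u) l = (l == k0)%:R + u * (sg * (l == k)%:R).
  have hE t : replace (idx k0) s (idx k (p s)) t = idx k (p t).
    by rewrite /replace; case: eqP => [->//|/eqP/pE].
  have -> : sg * (l == k)%:R =
            minors (coord_mx K (replace (idx k0) s (idx k (p s)))) l.
    rewrite -minors_coord_mx.
    have -> : coord_mx K (replace (idx k0) s (idx k (p s))) =
              coord_mx K (idx k) *m (perm_mx p)^T.
      rewrite tr_perm_mx -col_permE; apply/matrixP => i t.
      by rewrite !mxE hE.
    by rewrite minors_mulr det_tr det_perm.
  rewrite -minors_coord_mx -[X in X + _]mul1r /minors -!(det_tr (rowsub _ _)).
  apply: (determinant_multilinear (i0 := s)); apply/matrixP => i t;
    rewrite !mxE.
  - by rewrite /replace eqxx mul1r.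
  - by rewrite [lift _ _ == _]eq_sym (negbTE (neq_lift _ _)) mulr0 addr0.
  by rewrite /replace [lift _ _ == _]eq_sym (negbTE (neq_lift _ _)) mulr0 addr0.
pose w l := \det C * (sg * (l == k)%:R).
have [P PE dP] := meval_directional_deriv f (plucker x) w.
(* The condition keeps the coordinate of [k0] nonzero, hence the rank full; it excludes a single
   value of u, and only when k is [k0]. *)
have P0 u : 1 + u * (sg * (k0 == k)%:R) != 0 -> P.[u] = 0.
  move=> nz; have Mk0 : minors (M u) k0 != 0 by rewrite ME eqxx.
  have fM := row_full_minors Mk0.
  have : f.@[plucker (cspan (M u))] = 0.
    apply: f0; split=> [|l]; first exact: dim_cspan.
    rewrite plucker_cspan_eq0 // ME; have [->|_] := eqVneq l k0; first by [].
    by have [->|_] := eqVneq l k; rewrite // !mulr0 addr0 eqxx.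
  move/eqP; rewrite (meval_plucker_cspan hf) // => /eqP fM0.
  rewrite -PE (@meval_eq _ _ _ (fun l => \det C * minors (M u) l)).
    by rewrite (dhomog_mevalZ _ _ hf) fM0 mulr0.
  move=> l; rewrite ME mulrDr /w mulrCA; congr (_ + _).
  by rewrite -[plucker x]/(minors (basis_mx d x)) basisE minors_mulr
    minors_coord_mx.
have {}P0 : P = 0.
  have [s0 [us sz] s0r] := infinite_uniq_seq_avoid infK [:: - sg^-1] (size
    P).+1.
  apply/eqP/negPn/negP => nzP; have : all (root P) s0.
    apply/allP => u /s0r; rewrite inE => us0; apply/eqP/P0.
    case: (k0 == k); rewrite ?mulr1 ?mulr0 ?addr0 ?oner_eq0 //.
    apply: contra us0; rewrite addrC addr_eq0 => /eqP E.
    by rewrite -(mulfK sg0 u) E mulN1r.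
  by move/(max_poly_roots nzP)/(_ us); rewrite sz ltnNge leqnSn.
have := dP; rewrite P0 deriv0 horner0 (bigD1 k) //= big1 ?addr0 => [|l nlk].
  move/esym/eqP; rewrite /w eqxx mulr1 !mulf_eq0 (negbTE detC0) (negbTE sg0).
  by rewrite !orbF => /eqP.
by rewrite /w (negbTE nlk) !mulr0.
Qed.

Lemma tangentP y : tangent (interval_variety lo hi) x y <->
  (forall k, k \notin tangent_indices -> y 0 k = 0).
Proof.
split=> [ty k|y0 e f hf f0]; first exact: tangent_support.
apply: big1 => k _; have [kA|kA] := boolP (k \in tangent_indices).
  by rewrite (tangent_deriv kA hf f0) mul0r.
by rewrite y0 // mulr0.
Qed.

(** The cone [tangent] is a coordinate subspace with one dimension per index, and the local
    dimension is unique. *)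
Lemma smooth_at_interval_variety :
  smooth_at d (interval_variety lo hi) x <->
  #|tangent_indices| = (idx_sum hi - idx_sum lo).+1.
Proof.
have loc := interval_variety_local_dim infK lo_k0 k0_hi.
have [T TP dimT] := coordinate_subspace K tangent_indices.
split=> [[m [T' [locm T'P dimT']]]|cardA].
  have -> : (idx_sum hi - idx_sum lo = m)%N.
    case: loc locm => -[Z1 c1] b1 [[Z2 c2] b2]; apply/eqP.
    by rewrite eqn_leq (b2 _ _ c1) (b1 _ _ c2).
  rewrite -dimT -dimT'; congr (\dim _); apply/vspaceP => y.
  apply/idP/idP => [/TP Ty|/T'P ty]; first by apply/T'P/tangentP.
  by apply/TP/tangentP.
exists (idx_sum hi - idx_sum lo)%N, T; split=> // [y|]; last by rewrite dimT.
by rewrite TP tangentP.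
Qed.

End TangentSpace.

(** * Lengths and roots *)

Section PermLength.

Variables (n d : nat).
Hypothesis d_lt_n : (d < n)%N.

Implicit Types (u w : 'S_n) (k l : 'I_#|Idn n d|).

Let pos (t : 'I_d) : 'I_n := widen_ord (ltnW d_lt_n) t.

(** Ties a permutation to its coset through a matching, so that the sort in [coset_index] is
    unfolded only once. *)
Definition indexes u k : Prop :=
  exists p : 'S_d, forall t, u (widen_ord (ltnW d_lt_n) t) = idx k (p t).

Lemma pos_inj : injective pos.
Proof. by move=> s t /(congr1 val) /= E; apply: val_inj. Qed.

Lemma indexes_ex u : exists k, indexes u k.
Proof.
have [k [p hE]] := @sort_idx n d (u \o pos) (inj_comp (@perm_inj _ u) pos_inj).
by exists k, p.
Qed.

Lemma indexes_inj u k l : indexes u k -> indexes u l -> k = l.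
Proof.
move=> [p pE] [q qE]; apply: (@eq_idx_perm _ _ _ _ (q^-1 * p)%g) => t.
by rewrite permM -pE qE permKV.
Qed.

Lemma coset_index_idx u k :
  indexes u k -> coset_index d u = [seq idx k t | t <- enum 'I_d].
Proof.
case=> p pE; pose le := fun i j : 'I_n => (i <= j)%N.
have le_tr : transitive le by move=> i j l; apply: leq_trans.
have le_anti : antisymmetric le.
  by move=> i j ij; apply: val_inj; apply: anti_leq.
apply: (sorted_eq le_tr le_anti).
- by apply: sort_sorted => i j; apply: leq_total.
- rewrite sorted_map; apply: (@sub_sorted _ (relpre val ltn)).
    by move=> s t /= /(idx_mono k) /ltnW.
  by have := iota_ltn_sorted 0 d; rewrite -val_enum_ord sorted_map.
rewrite perm_sort; apply: uniq_perm.
- by rewrite map_inj_uniq; [rewrite filter_uniq // enum_uniq | apply: perm_inj].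
- by rewrite map_inj_uniq; [rewrite enum_uniq | apply: idx_inj].
move=> i; apply/mapP/mapP => [[j + ->]|[t _ ->]].
  rewrite mem_filter => /andP[jd _]; exists (p (Ordinal jd));
    rewrite ?mem_enum //.
  by rewrite -pE; congr (u _); apply: val_inj.
exists (pos (p^-1%g t)); last by rewrite pE permKV.
by rewrite mem_filter mem_enum /= ltn_ord.
Qed.

Lemma le_modP_idx u w k l :
  indexes u k -> indexes w l -> le_modP d u w = le_idx k l.
Proof.
move=> uk wl; rewrite /le_modP (coset_index_idx uk) (coset_index_idx wl).
rewrite all2E !size_map eqxx zip_map all_map /=.
apply/allP/le_idxP => le_kl t; last by move=> _; apply: le_kl.
by apply: le_kl; rewrite mem_enum.
Qed.

(* A simple reflection changes [top_sum] by at most one, which bounds lengths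
   from below. *)
Definition top_sum u : nat := \sum_t u (pos t).

Lemma top_sum_idx u k : indexes u k -> top_sum u = idx_sum k.
Proof.
case=> p pE; rewrite /idx_sum (reindex_inj (@perm_inj _ p)).
by apply: eq_bigr => t _; rewrite pE.
Qed.

Lemma top_sum1_le u : (top_sum 1%g <= top_sum u)%N.
Proof.
have [k uk] := indexes_ex u; rewrite (top_sum_idx uk); apply: leq_sum => t _.
rewrite perm1 /=; suff le_idx_val m (lt_m : (m < d)%N) : (m <= idx k (Ordinal
  lt_m))%N.
  by have := le_idx_val t (ltn_ord t); congr (_ <= idx k _)%N; apply: val_inj.
elim: m lt_m => // m IHm lt_m.
have := idx_mono k (s := Ordinal (ltnW lt_m)) (t := Ordinal lt_m) (ltnSn _).
exact: leq_ltn_trans (IHm (ltnW lt_m)).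
Qed.

Lemma perm_lengthP u m : u \in (simple_refl n ^+ m)%g -> (perm_length u <= m)%N.
Proof. by rewrite /perm_length; case: ex_minnP => l _ min_l /min_l. Qed.

Lemma perm_length_mem u : u \in (simple_refl n ^+ perm_length u)%g.
Proof. by rewrite /perm_length; case: ex_minnP. Qed.

Lemma perm_length_mulr u (s : 'S_n) :
  s \in simple_refl n -> (perm_length (u * s)%g <= (perm_length u).+1)%N.
Proof.
by move=> sS; apply: perm_lengthP; rewrite expgSr mem_mulg ?perm_length_mem.
Qed.

Lemma top_sum_mulr u s :
  s \in simple_refl n -> (top_sum (u * s)%g <= (top_sum u).+1)%N.
Proof.
case/imsetP => -[i j]; rewrite inE /= => /eqP ji ->.
apply: (@leq_trans (\sum_t (u (pos t) + (u (pos t) == i)))).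
  apply: leq_sum => t _; rewrite permM; case: tpermP => [->|->|_ _] //.
  - by rewrite eqxx ji addn1.
  - by rewrite ji; lia.
  exact: leq_addr.
rewrite big_split /= -addn1 leq_add2l.
have [[t0 t0i]|none] := altP (@existsP _ (fun t => u (pos t) == i)).
  rewrite (bigD1 t0) //= t0i big1 // => t tt0; apply/eqP; rewrite eqb0.
  by rewrite -(eqP t0i) (inj_eq (@perm_inj _ u)) (inj_eq pos_inj).
rewrite big1 // => t _; apply/eqP; rewrite eqb0.
by move: none; rewrite negb_exists => /forallP.
Qed.

Lemma top_sum_le_length u : (top_sum u <= top_sum 1%g + perm_length u)%N.
Proof.
suff le_top m : forall w, w \in (simple_refl n ^+ m)%g ->
    (top_sum w <= top_sum 1%g + m)%N by apply/le_top/perm_length_mem.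
elim: m => [|m IHm] {}u.
  by rewrite expg0 => /set1P ->; rewrite addn0.
rewrite expgSr => /mulsgP[u' s /IHm le_u' sS ->].
by rewrite addnS (leq_trans (top_sum_mulr _ sS)).
Qed.

Lemma W_P_of_stable w : (forall j : 'I_n,
  (j < d)%N -> (w j < d)%N) -> w \in W_P n d.
Proof.
move=> stab; rewrite inE; apply/forallP => j; apply/eqP; apply/idP/idP;
  last exact: stab.
pose D := [set i : 'I_n | (i < d)%N].
have /eqP wD : w @: D == D.
  rewrite eqEcard card_imset ?leqnn ?andbT; last exact: perm_inj.
  by apply/subsetP => _ /imsetP[i + ->]; rewrite !inE => /stab.
move=> wj; have : w j \in w @: D by rewrite wD inE.
by rewrite mem_imset ?inE //; apply: perm_inj.
Qed.

(** As long as some value i sits beyond the first d positions while i+1 sits among them, the simple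
    reflection swapping the two lowers [top_sum] by one. When there is none, w lies in [W_P] and its
    inverse brings it to the identity. *)
Lemma coset_rep_length w :
  exists2 u, u \in W_P n d & (perm_length (u * w)%g + top_sum 1%g <= top_sum
    w)%N.
Proof.
have [m] := ubnP (top_sum w); elim: m w => // m IHm w; rewrite ltnS => le_m.
case: (pickP [pred ij : 'I_n * 'I_n | [&& ij.2 == ij.1.+1 :> nat,
    (d <= w^-1%g ij.1)%N & (w^-1%g ij.2 < d)%N]]).
  move=> [i j] /= /and3P[/eqP ji di jd]; pose s := tperm i j.
  have sS : s \in simple_refl n by apply/imsetP; exists (i, j);
    rewrite ?inE ?ji.
  have sum_s : top_sum w = (top_sum (w * s)%g).+1.
    rewrite /top_sum (bigD1 (Ordinal jd)) // [X in _ = X.+1](bigD1 (Ordinal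
      jd)) //=.
    have -> : pos (Ordinal jd) = w^-1%g j by apply: val_inj.
    rewrite permM permKV tpermR ji addSn; congr (_ + _).+1.
    apply: eq_bigr => t tj; rewrite permM tpermD //.
      apply: contraTneq di => ->; rewrite permK -ltnNge; exact: ltn_ord t.
    apply: contraNneq tj => jE; apply/eqP/val_inj => /=.
    by rewrite [X in w^-1%g X]jE permK.
  have [|u uW le_u] := IHm (w * s)%g; first by rewrite -sum_s.
  exists u => //; have -> : (u * w = (u * (w * s)) * s)%g.
    by rewrite -!mulgA tperm2 mulg1.
  rewrite sum_s; apply: leq_trans (_ : (perm_length (u * (w * s))%g + top_sum
    1%g).+1 <= _)%N.
    by rewrite -addSn leq_add2r; apply: perm_length_mulr.
  by rewrite ltnS.
move=> none; have down (i j : 'I_n) : j = i.+1 :> nat -> (w^-1%g j < d)%N ->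
  (w^-1%g i < d)%N.
  move=> ji jd; have /negbT := none (i, j).
  by rewrite /= ji eqxx jd andbT /= -ltnNge.
(* The values at the first d positions form an initial segment of the indices. *)
have downs (i j : 'I_n) : (i <= j)%N -> (w^-1%g j < d)%N -> (w^-1%g i < d)%N.
  move=> + jd; elim: {i}(j - i)%N {-2}i (erefl (j - i)%N) =>
    [|e IHe] i e_ij le_ij.
    by have -> : i = j by apply: val_inj => /=; lia.
  have lt_i : (i.+1 < n)%N by have := ltn_ord j; lia.
  by apply: (down i (Ordinal lt_i)) => //; apply: IHe => /=; lia.
have wW : w \in W_P n d.
  apply: W_P_of_stable => j jd; rewrite ltnNge; apply/negP => d_wj.
  pose D := [set i : 'I_n | (i <= w j)%N].
  have : (#|w^-1%g @: D| <= d)%N.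
    apply: (@leq_trans #|[set i : 'I_n | 0 <= i < d]|); last first.
      by rewrite (leq_trans (card_ord_interval _ _ _)) ?subn0.
    apply/subset_leq_card/subsetP => _ /imsetP[i + ->]; rewrite !inE /= => le_i.
    by apply: downs le_i _; rewrite permK.
  rewrite card_imset; last exact: perm_inj.
  rewrite leqNgt => /negP; apply; apply: leq_trans (_ : (w j).+1 <= _)%N => //.
  have wjn : ((w j).+1 <= n)%N by exact: ltn_ord.
  have inj_wd : injective (widen_ord wjn).
    by move=> a b /(congr1 val) /= E; apply: val_inj.
  rewrite -[X in (X <= _)%N]card_ord -(card_imset _ inj_wd).
  by apply/subset_leq_card/subsetP => _ /imsetP[i _ ->]; rewrite inE /= -ltnS.
exists w^-1%g; last first.
  have -> : perm_length (w^-1 * w)%g = 0%N.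
    by apply/eqP; rewrite mulVg -leqn0 perm_lengthP // expg0 inE.
  by rewrite add0n top_sum1_le.
rewrite inE; apply/forallP => j; have := wW; rewrite inE =>
  /forallP/(_ (w^-1%g j)).
by rewrite permKV eq_sym.
Qed.

(** Minimality in the coset gives one inequality through [coset_rep_length], the growth bound on
    [top_sum] the other. The term of the identity cancels in differences of lengths. *)
Lemma min_rep_length w k : w \in min_reps n d -> indexes w k ->
  (perm_length w + top_sum 1%g = idx_sum k)%N.
Proof.
rewrite inE => /forallP min_w wk; rewrite -(top_sum_idx wk).
have [u uW le_u] := coset_rep_length w.
have /implyP/(_ uW) le_w := min_w u.
by have := top_sum_le_length w; lia.
Qed.

End PermLength.

(** * Schubert and Richardson varieties as interval varieties *)

Section GrassmannRichardson.

Local Open Scope ring_scope.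

Variables (K : fieldType) (n d : nat).
Hypothesis infK : infinite_field K.
Hypothesis d_lt_n : (d < n)%N.

Implicit Types (u v w : 'S_n) (k l : 'I_#|Idn n d|) (U : {vspace 'cV[K]_n}).

Local Notation indexes := (indexes d_lt_n).

Lemma fixed_pt_cspan u k :
  indexes u k -> fixed_pt K d u = cspan (coord_mx K (idx k)).
Proof.
case=> p pE; rewrite -(cspan_coord_mx_perm K pE).
set h := fun t => u _; rewrite /fixed_pt; apply/eqP; rewrite eqEsubv;
  apply/andP; split.
  apply/span_subvP => _ /mapP[j + ->]; rewrite mem_filter => /andP[jd _].
  apply/cspanP; exists (delta_mx (Ordinal jd) 0); rewrite -colE.
  apply/colP => i; rewrite !mxE andbT /h; congr (i == u _)%:R; exact: val_inj.
apply/subvP => _ /cspanP[y ->].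
have -> : coord_mx K h *m y = \sum_t y t 0 *: delta_mx (h t) 0.
  apply/colP => i; rewrite mxE summxE; apply: eq_bigr => t _.
  by rewrite !mxE andbT mulrC.
apply: memv_suml => t _; apply/memvZ/memv_span/map_f.
by rewrite mem_filter mem_enum /= ltn_ord.
Qed.

Lemma borel_rank (g : 'M[K]_n) : borel g <-> rank_borel (@nat_of_ord n) g.
Proof.
split=> -[dg tg]; split=> //.
  move=> i j nz; rewrite leqNgt; apply/negP => ji; case/eqP: nz.
  by have /is_trig_mxP/(_ _ _ ji) := tg; rewrite mxE.
apply/is_trig_mxP => i j ij; rewrite mxE; apply/eqP/negPn/negP => /tg.
by rewrite leqNgt ij.
Qed.

Lemma borel_opp_rank (g : 'M[K]_n) :
  borel_opp g <-> rank_borel (fun i : 'I_n => (n - i)%N) g.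
Proof.
split=> -[dg tg]; split=> //.
  move=> i j nz; apply: leq_sub2l; rewrite leqNgt; apply/negP => ij.
  by case/eqP: nz; have /is_trig_mxP/(_ _ _ ij) := tg.
apply/is_trig_mxP => i j ij; apply/eqP/negPn/negP => /tg.
by have := ltn_ord j; lia.
Qed.

Lemma eq_zclosure (Y Z : {vspace 'cV[K]_n} -> Prop) U :
  (forall V, Y V <-> Z V) -> zclosure d Y U <-> zclosure d Z U.
Proof. by move=> YZ; split; apply: zclosureS => V /YZ. Qed.

Lemma schubertP w k U : indexes w k ->
  schubert d w U <->
  grass d U /\ forall l : 'I_#|Idn n d|, plucker U l != 0 -> le_idx l k.
Proof.
move=> wk; rewrite /schubert (fixed_pt_cspan wk).
rewrite (@eq_zclosure _ (fun V : {vspace 'cV[K]_n} => exists2 g : 'M[K]_n,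
  rank_borel (@nat_of_ord n) g &
    V = Defs.act g (cspan (coord_mx K (idx k))))); last first.
  by move=> V; split=> -[g /borel_rank bg ->]; exists g.
rewrite (zclosure_rank_borel_orbit infK d_lt_n (@ord_inj n)) //; last first.
- move=> M /two_sided_echelon[C uC [a [b ech]]]; exists C => //.
  by exists b; [case: ech | apply: leading_bottom ech].
- exact: idx_inj.
split=> -[gU supU]; split=> // l /supU; last first.
  by move=> /le_idxP le_lk; exists 1%g => t; rewrite perm1.
by case=> p; apply: le_idx_matching.
Qed.

Lemma schubert_oppP v k U : indexes v k ->
  schubert_opp d v U <->
  grass d U /\ forall l : 'I_#|Idn n d|, plucker U l != 0 -> le_idx k l.
Proof.
move=> vk; rewrite /schubert_opp (fixed_pt_cspan vk).
rewrite (@eq_zclosure _ (fun V : {vspace 'cV[K]_n} => exists2 g : 'M[K]_n,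
  rank_borel (fun i : 'I_n => (n - i)%N) g &
    V = Defs.act g (cspan (coord_mx K (idx k))))); last first.
  by move=> V; split=> -[g /borel_opp_rank bg ->]; exists g.
rewrite (zclosure_rank_borel_orbit infK d_lt_n (@rev_rank_inj n)) //;
  last first.
- move=> M /two_sided_echelon[C uC [a [b ech]]]; exists C => //.
  by exists a; [case: ech | apply: leading_top ech].
- exact: idx_inj.
split=> -[gU supU]; split=> // l /supU; last first.
  by move=> /le_idxP le_kl; exists 1%g => t; rewrite perm1 leq_sub2l.
case=> p le_p; apply: (@le_idx_matching _ _ _ _ p^-1%g) => t.
have := le_p (p^-1%g t); rewrite permKV.
by have := ltn_ord (idx l t); have := ltn_ord (idx k (p^-1%g t)); lia.
Qed.

Lemma richardsonP w v kw kv U : indexes w kw -> indexes v kv ->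
  richardson d w v U <-> interval_variety kv kw U.
Proof.
move=> wk vk; rewrite /richardson (schubertP _ wk) (schubert_oppP _ vk).
split=> [[[gU le_w] [_ le_v]]|[gU supU]].
  by split=> // k Uk; split; [apply: le_v | apply: le_w].
by split; split=> // k /supU[].
Qed.

(** Subsets are predicates compared pointwise, so smoothness has to be transported through its
    definition. *)
Lemma eq_smooth_at (X Y : {vspace 'cV[K]_n} -> Prop) x :
  (forall U, X U <-> Y U) -> smooth_at d X x <-> smooth_at d Y x.
Proof.
have half (X' Y' : {vspace 'cV[K]_n} -> Prop) :
    (forall U, X' U <-> Y' U) -> smooth_at d X' x -> smooth_at d Y' x.
  move=> XY [m [T [[[Z [irrZ strictZ]] maxZ] TP dimT]]]; exists m, T.
  split=> // [|y].
    split=> [|m' Z' [irrZ' strictZ']].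
      exists Z; split=> // i im; have [cZ iZ ZX Zx] := irrZ i im.
      by split=> // U /ZX/XY.
    apply: (maxZ m' Z'); split=> // i im; have [cZ iZ ZX Zx] := irrZ' i im.
    by split=> // U /ZX/XY.
  by rewrite TP; split=> ty k f hf f0; apply: (ty k f hf) => U /XY/f0.
by move=> XY; split; apply: half => // U; rewrite XY.
Qed.

End GrassmannRichardson.

(** * Roots outside the Levi factor and exchanged indices *)

Section RootCount.

Variables (n d : nat).
Hypothesis d_lt_n : (d < n)%N.
Hypothesis d_gt0 : (0 < d)%N.

Local Notation indexes := (indexes d_lt_n).
Local Notation pos := (widen_ord (ltnW d_lt_n)).

Implicit Types (tau : 'S_n) (a b : 'I_n * 'I_n) (k : 'I_#|Idn n d|).

Lemma grass_rootP a :
  (a \in pos_roots n :\: pos_roots_P n d) = (a.1 < d <= a.2)%N.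
Proof.
rewrite !inE; case: (ltnP a.1 d); case: (ltnP a.2 d);
  by case: (ltnP a.1 a.2) => //=; lia.
Qed.

Lemma root_refl_pos tau a (t : 'I_d) : (a.1 < d <= a.2)%N ->
  (root_refl a * tau)%g (pos t) = if pos t == a.1 then tau a.2 else tau (pos t).
Proof.
move=> /andP[_ da]; rewrite permM /root_refl; case: eqP => [->|/eqP ta].
  by rewrite tpermL.
rewrite tpermD // eq_sym // -val_eqE /=; have := ltn_ord t.
by rewrite neq_ltn => /leq_trans -> //; rewrite ?orbT.
Qed.

Lemma indexes_codom tau k i : indexes tau k ->
  (i \in codom (idx k)) = (tau^-1%g i < d)%N.
Proof.
case=> p pE; apply/codomP/idP => [[t ->]|lt_i].
  by rewrite -(permKV p t) -pE permK /= ltn_ord.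
exists (p (Ordinal lt_i)); rewrite -pE -{1}(permKV tau i); congr (tau _).
exact: val_inj.
Qed.

Variables (tau : 'S_n) (k0 : 'I_#|Idn n d|).
Hypothesis tau_k0 : indexes tau k0.

(** The reflection replaces the entry [tau a.1] by [tau a.2]. Tracking sets of entries avoids
    sorting the new tuple. *)
Lemma root_refl_codom a k i : (a.1 < d <= a.2)%N ->
    indexes (root_refl a * tau)%g k ->
  (i \in codom (idx k)) =
    (i == tau a.2) || (i \in codom (idx k0)) && (i != tau a.1).
Proof.
move=> /andP[a1 a2] kP; rewrite (indexes_codom _ kP) (indexes_codom _ tau_k0).
rewrite invMg permM /root_refl tpermV.
have tauE j : (i == tau j) = (tau^-1%g i == j).
  by rewrite -(inj_eq (@perm_inj _ tau) (tau^-1%g i)) permKV.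
rewrite !tauE.
case: tpermP => [->|->|/eqP n1 /eqP n2].
- have n12 : a.1 != a.2 by apply: contraTneq a1 => ->; rewrite -leqNgt.
  by rewrite eqxx andbF orbF (negbTE n12) ltnNge a2.
- by rewrite eqxx.
by rewrite (negbTE n1) (negbTE n2) andbT.
Qed.

Lemma root_refl_exchange a k : (a.1 < d <= a.2)%N ->
  indexes (root_refl a * tau)%g k -> exchange k0 k && (k != k0).
Proof.
move=> ad kP; have [a1 a2] := andP ad; apply/andP; split.
  have [q qE] := tau_k0; have [p pE] := kP.
  apply/exchangeP; exists (q^-1 * p)%g, (q (Ordinal a1)) => t ts.
  rewrite permM -pE root_refl_pos // -val_eqE /=; case: eqP => [E|_].
    case/eqP: ts; rewrite -(permKV q t); congr (q _); exact: val_inj.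
  by rewrite qE permKV.
apply: contraTneq a2 => kk0; rewrite -ltnNge -{1}(permK tau a.2).
by rewrite -(indexes_codom _ tau_k0) -kk0 (root_refl_codom _ ad kP) eqxx.
Qed.

(** The root is recovered from k: [tau a.2] is the entry gained and [tau a.1] the entry lost. *)
Lemma root_refl_idx_inj a b k : (a.1 < d <= a.2)%N -> (b.1 < d <= b.2)%N ->
  indexes (root_refl a * tau)%g k -> indexes (root_refl b * tau)%g k -> a = b.
Proof.
move=> ad bd ka kb.
have E i := etrans (esym (root_refl_codom i ad ka)) (root_refl_codom i bd kb).
have out (c : 'I_n * 'I_n) : (c.1 < d <= c.2)%N -> [/\ tau c.1 \in codom (idx
  k0),
    (tau c.2 \in codom (idx k0)) = false & (tau c.1 == tau c.2) = false].
  move=> /andP[c1 c2]; rewrite !(indexes_codom _ tau_k0) !permK c1 ltnNge c2.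
  split=> //; rewrite (inj_eq perm_inj); apply/eqP => c12.
  by rewrite c12 ltnNge c2 in c1.
have [a1_in a2_out a12] := out a ad; have [b1_in b2_out b12] := out b bd.
have := E (tau a.2); rewrite eqxx a2_out /= orbF =>
  /esym/eqP/(@perm_inj _ tau) a2.
have := E (tau a.1); rewrite eqxx andbF orbF a12 a1_in -a2 a12 /=.
move=> /esym/negbFE/eqP/(@perm_inj _ tau) a1.
by case: a b a1 a2 {ad bd ka kb E a1_in a2_out a12 b1_in b2_out b12} =>
  ? ? [? ?] /= -> ->.
Qed.

Lemma exchange_root_refl k : exchange k0 k -> k != k0 ->
  exists2 a : 'I_n * 'I_n, (a.1 < d <= a.2)%N & indexes (root_refl a * tau)%g k.
Proof.
move=> /exchangeP[p [s pE]] nk0; have [q qE] := tau_k0.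
have out : idx k (p s) \notin codom (idx k0).
  apply/negP => /codomP[u E]; case/eqP: nk0.
  have us : u = s.
    have [//|us] := eqVneq u s; have := pE u us; rewrite -E =>
      /idx_inj/perm_inj E'.
    by rewrite E' eqxx in us.
  apply: (@eq_idx_perm _ _ _ _ p) => t; have [->|/pE//] := eqVneq t s.
  by rewrite E us.
rewrite (indexes_codom _ tau_k0) -leqNgt in out.
(* The positions under tau of the entry of [k0] that is given up and of the value that replaces
   it. *)
pose a : 'I_n * 'I_n := (pos (q^-1%g s), tau^-1%g (idx k (p s))).
have ad : (a.1 < d <= a.2)%N by rewrite /= ltn_ord.
exists a => //; exists (q * p)%g => t; rewrite root_refl_pos // permM.
rewrite -val_eqE /=; case: eqP => [E|nE].
  have -> : q t = s by rewrite -(permKV q s); congr (q _); apply: val_inj.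
  by rewrite permKV.
rewrite qE pE //; apply/eqP => qt; apply: nE; by rewrite -qt permK.
Qed.

(** Roots correspond bijectively to the exchanged indices other than [k0]; the successor accounts
    for [k0]. *)
Lemma card_tangent_indices w v kw kv : indexes w kw -> indexes v kv ->
    le_idx kv k0 -> le_idx k0 kw ->
  #|tangent_indices kv k0 kw| =
  #|[set a in pos_roots n :\: pos_roots_P n d |
        le_modP d (root_refl a * tau)%g w
        && le_modP d v (root_refl a * tau)%g]|.+1.
Proof.
move=> wk vk v0 w0; set R := [set a in _ | _].
have /fin_all_exists[kk kkP] (a : 'I_n * 'I_n) := indexes_ex d_lt_n (root_refl
  a * tau)%g.
have inR a : (a \in R) = (a.1 < d <= a.2)%N && (le_idx kv (kk a) && le_idx (kk
  a) kw).
  rewrite inE grass_rootP (le_modP_idx (kkP a) wk) (le_modP_idx vk (kkP a)).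
  by rewrite [X in _ && X]andbC.
rewrite (cardsD1 k0) inE exchange_refl // v0 w0 add1n; congr _.+1.
rewrite -(card_in_imset (f := kk) (D := mem R)); last first.
  move=> a b; rewrite !inR => /andP[ad _] /andP[bd _] E.
  by apply: (@root_refl_idx_inj a b (kk a)) => //; rewrite ?E.
apply: eq_card => k; rewrite !inE; apply/andP/imsetP.
  case=> nk0 /andP[ex kint]; have [a ad ka] := exchange_root_refl ex nk0.
  have kE : k = kk a := indexes_inj ka (kkP a).
  by exists a; rewrite // inR ad -kE.
case=> a; rewrite inR => /andP[ad kint] ->.
by have /andP[-> ->] := root_refl_exchange ad (kkP a); rewrite kint.
Qed.

End RootCount.

Lemma closedField_infinite (K : closedFieldType) : infinite_field K.
Proof.
(* The root 0 added to s keeps the polynomial nonconstant when s is empty. At a root of p the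
   product equals -1, so that root is not in s. *)
move=> s; pose p : {poly K} := (\prod_(a <- 0%R :: s) ('X - a%:P) + 1)%R.
have /closed_rootP[x px] : size p != 1.
  by rewrite /p size_polyDl size_prod_XsubC // size_poly1.
exists x; apply/negP => xs; have : root (\prod_(a <- 0%R :: s) ('X - a%:P))%R x.
  by rewrite root_prod_XsubC inE xs orbT.
rewrite /root => /eqP E; move: px; rewrite /root /p hornerD E hornerC add0r.
by rewrite oner_eq0.
Qed.

Theorem corollary6p7p3 (K : closedFieldType) (n d : nat)
    (d_gt0 : (0 < d)%N) (d_lt_n : (d < n)%N) (w tau v : 'S_n)
    (wP : w \in min_reps n d) (tauP : tau \in min_reps n d)
    (vP : v \in min_reps n d)
    (le_tau_w : le_modP d tau w) (le_v_tau : le_modP d v tau) :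
  smooth_at d (richardson (K := K) d w v) (fixed_pt K d tau) <->
  ((perm_length w)%:Z - (perm_length v)%:Z =
   #|[set a in pos_roots n :\: pos_roots_P n d |
        le_modP d (root_refl a * tau)%g w
        && le_modP d v (root_refl a * tau)%g]|%:Z)%R.
Proof.
have infK := @closedField_infinite K.
have [[kw wk] [kt tk] [kv vk]] :=
  And3 (indexes_ex d_lt_n w) (indexes_ex d_lt_n tau) (indexes_ex d_lt_n v).
rewrite (le_modP_idx tk wk) in le_tau_w;
  rewrite (le_modP_idx vk tk) in le_v_tau.
rewrite (@eq_smooth_at _ _ _ _ (interval_variety kv kw)); last first.
  by move=> U; apply: richardsonP wk vk.
rewrite (fixed_pt_cspan K tk).
rewrite (smooth_at_interval_variety infK d_gt0 le_v_tau le_tau_w).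
rewrite (card_tangent_indices d_gt0 tk wk vk) //; set c := #|_|.
have lw := min_rep_length wP wk; have lv := min_rep_length vP vk.
(* Ensures that the truncated difference of sums in the dimension is the integer difference of the
   lengths. *)
have le_vw := leq_trans (idx_sum_le le_v_tau) (idx_sum_le le_tau_w).
by split=> [[]|]; lia.
Qed.
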